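(* Let $(M,\omega)$ be a closed symplectic manifold, $\mathcal G=\mathrm{Ham}(M,\omega)$, and let $\mathfrak S:\widetilde{\mathcal G}\to\mathbb R$ be the homogeneous quasimorphism described in the context. Then $\mathfrak{S}$ is invariant with respect to conjugation by elements of $\widetilde{\mathrm{Symp}}(M,\omega)$, or equivalently by elements of $\mathrm{Symp}(M,\omega)$.
   Context: $\dim M=2n$. Elements of $\widetilde{\mathcal G}$ are homotopy classes with fixed endpoints of paths $\{\phi_t\}_{t\in[0,1]}$ in $\mathcal G$ with $\phi_0=\mathrm{Id}$; $\psi\in\mathrm{Symp}(M,\omega)$ conjugates by $\psi[\{\phi_t\}]\psi^{-1}=[\{\psi\phi_t\psi^{-1}\}]$, and an element of $\widetilde{\mathrm{Symp}}(M,\omega)$ with endpoint $\psi$ conjugates in the same way. $X_t$ is the vector field generating $\{\phi_t\}$ and $H_t$ the Hamiltonian, $\iota_{X_t}\omega=-dH_t$, normalized by $\int_MH_t\,\omega^n=0$. The quasimorphism $\mathfrak S$. Let $\mathcal J$ be the (contractible) space of $\omega$-compatible almost complex structures $J$ on $M$, with $g(J)(\xi,\eta)=\omega(\xi,J\eta)$ and $h(J)=g(J)-i\omega$; $\mathcal G$ acts by $\phi\cdot J=\phi_*J$. For $x\in M$ let $\mathcal S_x\cong Sp(2n,\mathbb R)/U(n)$ be the space of $\omega_x$-compatible complex structures on $T_xM$, with the invariant Kähler form $(\sigma_x)_J(A,B)=\frac14\mathrm{trace}(JAB)$ and its invariant metric (a constant multiple of $\mathrm{trace}(AB)$). Put $\Omega(A,B)=\int_M\sigma_x(A_x,B_x)\,\omega^n(x)$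 for $A,B\in T_J\mathcal J$. For $J_0,J_1\in\mathcal J$ let $[J_0,J_1]$ be the path in $\mathcal J$ that over each $x\in M$ is the unique geodesic in $\mathcal S_x$ from $(J_0)_x$ to $(J_1)_x$. For $J\in\mathcal J$ let $\nabla$ be the canonical connection on $(TM,J,h(J))$, defined by $\nabla J=0$, $\nabla h=0$, $T_\nabla^{(1,1)}=0$; let $i\rho$ be the curvature of the induced connection on $\Lambda^n_{\mathbb C}(TM,J)$, with $\rho$ a closed real two-form on $M$; the Hermitian scalar curvature $S(J)$ is defined by $S(J)\,\omega^n=n\,\rho\wedge\omega^{n-1}$. The (Donaldson–Fujiki) moment map for the action of $\mathcal G$ on $(\mathcal J,\Omega)$ is $\mu(H)(J)=\int_MS(J)H\,\omega^n$. Fix $J_0\in\mathcal J$ and put $\mathfrak S_{J_0}([\{\phi_t\}])=\int_D\Omega-\int_0^1\mu(H_t)(\phi_t\cdot J_0)\,dt$, where $D$ is any disk in $\mathcal J$ filling the loop $\{\phi_t\cdot J_0\}\,\#\,[\phi_1\cdot J_0,J_0]$. Then $\mathfrak S(\widetilde\phi)=\lim_{k\to\infty}\frac1k\mathfrak S_{J_0}(\widetilde\phi^{\,k})$, independent of $J_0$. *)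

(* Defs.v *)
From HB Require Import structures.
From mathcomp Require Import all_boot all_order all_algebra perm.
From mathcomp Require Import all_classical all_reals all_analysis.
From mathcomp Require Import complex.

Set Implicit Arguments.
Unset Strict Implicit.
Unset Printing Implicit Defensive.

Import Order.TTheory GRing.Theory Num.Theory.
Import numFieldNormedType.Exports.

Local Open Scope classical_set_scope.
Local Open Scope ring_scope.

Section Euclidean.
Context {R : realType}.

Definition basis_vec (N : nat) (i : 'I_N) : 'rV[R]_N := delta_mx 0 i.

(* f is C^k on the open set U: all iterated partial derivatives of order <= k
   exist and are continuous on U. *)
Fixpoint Ck (N k : nat) (U : set 'rV[R]_N) (f : 'rV[R]_N -> R) : Prop :=
  (forall x, U x -> {for x, continuous f}) /\
  match k with
  | 0 => True
  | k'.+1 => forall i : 'I_N,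
      (forall x, U x -> derivable f x (basis_vec i)) /\
      Ck k' U (fun x => 'D_(basis_vec i) f x)
  end.

Definition Cinf (N : nat) (U : set 'rV[R]_N) (f : 'rV[R]_N -> R) : Prop :=
  forall k, Ck k U f.

Definition Cinf_map (N N' : nat) (U : set 'rV[R]_N)
    (F : 'rV[R]_N -> 'rV[R]_N') : Prop :=
  forall j, Cinf U (fun x => F x 0 j).

(* The Lebesgue integral over R^N of a nonnegative measurable function, as an
   iterated integral (Tonelli). *)
Fixpoint int_rV (N : nat) : ('rV[R]_N -> \bar R) -> \bar R :=
  match N with
  | 0 => fun f => f 0
  | N'.+1 => fun f =>
      (\int[@lebesgue_measure R]_(x in setT)
         int_rV (fun y : 'rV[R]_N' => f (row_mx (x%:M : 'rV[R]_1) y)))%E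
  end.

Definition cube (k : nat) : set 'rV[R]_k :=
  [set z | forall i, 0 <= z 0 i <= 1].

End Euclidean.

Section Manifold.
Context {R : realType} {M : ptopologicalType}.

(* cmap and cinv are only meaningful on cdom and on its image. *)
Record chart (m : nat) := Chart {
  cdom : set M ;
  cmap : M -> 'rV[R]_m ;
  cinv : 'rV[R]_m -> M }.

Definition cimg (m : nat) (c : chart m) : set 'rV[R]_m := cmap c @` cdom c.

Definition is_chart (m : nat) (c : chart m) : Prop :=
  [/\ open (cdom c), open (cimg c),
      (forall x, cdom c x -> cinv c (cmap c x) = x),
      (forall x, cdom c x -> {for x, continuous (cmap c)}) &
      (forall y, cimg c y -> {for y, continuous (cinv c)})].

Definition transition_smooth (m : nat) (c d : chart m) : Prop :=
  Cinf_map (cmap c @` (cdom c `&` cdom d)) (cmap d \o cinv c).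

Definition chart_compatible (m : nat) (c d : chart m) : Prop :=
  transition_smooth c d /\ transition_smooth d c.

End Manifold.
Arguments chart R M m : clear implicits.

(* A smooth structure is a maximal smooth atlas. *)
Record smooth_structure (R : realType) (M : ptopologicalType) (m : nat) :=
  SmoothStructure {
    atlas : set (chart R M m) ;
    atlas_chart : forall c, atlas c -> is_chart c ;
    atlas_cover : forall x : M, exists2 c, atlas c & cdom c x ;
    atlas_compat : forall c d, atlas c -> atlas d -> chart_compatible c d ;
    atlas_max : forall c, is_chart c ->
      (forall d, atlas d -> chart_compatible c d) -> atlas c }.

Section Smooth.
Context {R : realType} {M : ptopologicalType} {m : nat}.
Variable A : smooth_structure R M m.

(* Smoothness of (z, x) |-> F z x on the manifold with corners [0,1]^k x M: in
   each chart, F extends locally to a smooth function on an open set. *)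
Definition smooth_fam (k : nat) (F : 'rV[R]_k -> M -> R) : Prop :=
  forall z x c, cube z -> atlas A c -> cdom c x ->
  exists (U : set 'rV[R]_(k + m)) (g : 'rV[R]_(k + m) -> R),
    [/\ open U, U (row_mx z (cmap c x)), Cinf U g &
        forall z' y, U (row_mx z' y) -> cube z' -> cimg c y ->
          F z' (cinv c y) = g (row_mx z' y)].

(* The same for M-valued families, in charts c of the source and d of the
   target. *)
Definition smooth_map_fam (k : nat) (F : 'rV[R]_k -> M -> M) : Prop :=
  forall z x c d, cube z -> atlas A c -> atlas A d -> cdom c x -> cdom d (F z x) ->
  exists (U : set 'rV[R]_(k + m)) (G : 'rV[R]_(k + m) -> 'rV[R]_m),
    [/\ open U, U (row_mx z (cmap c x)), Cinf_map U G &
        forall z' y, U (row_mx z' y) -> cube z' -> cimg c y ->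
          cdom d (F z' (cinv c y)) /\
          cmap d (F z' (cinv c y)) = G (row_mx z' y)].

Definition smooth_fun (f : M -> R) : Prop :=
  smooth_fam (fun _ : 'rV[R]_0 => f).

Definition smooth_map (f : M -> M) : Prop :=
  smooth_map_fam (fun _ : 'rV[R]_0 => f).

Definition finv (f : M -> M) : M -> M := fun y => xget y [set x | f x = y].

Definition diffeo (f : M -> M) : Prop :=
  [/\ bijective f, smooth_map f & smooth_map (finv f)].

(* Tangent vectors at x are the derivations at x of C^oo(M), extended by 0 to
   the functions that are not smooth (so that equal derivations are equal
   Rocq functions). *)
Definition vec := (M -> R) -> R.

Definition tangent (x : M) : set vec := [set v |
  [/\ (forall a f g, smooth_fun f -> smooth_fun g ->
         v (fun y => a * f y + g y) = a * v f + v g),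
      (forall f g, smooth_fun f -> smooth_fun g ->
         v (fun y => f y * g y) = v f * g x + f x * v g) &
      (forall f, ~ smooth_fun f -> v f = 0)]].

Definition dmap (f : M -> M) (v : vec) : vec := fun h => v (h \o f).

Definition vfield (X : M -> vec) : Prop :=
  (forall x, tangent x (X x)) /\
  (forall f, smooth_fun f -> smooth_fun (fun x => X x f)).

Definition bracket (X Y : M -> vec) : M -> vec :=
  fun x f => X x (fun y => Y y f) - Y x (fun y => X y f).

Definition smul (f : M -> R) (X : M -> vec) : M -> vec :=
  fun x => f x *: X x.

(* Fibrewise bilinear forms and endomorphisms of TM; their values are only
   meaningful on tangent vectors. *)
Definition bform := M -> vec -> vec -> R.
Definition endo := M -> vec -> vec.

Definition two_form (b : bform) : Prop :=
  [/\ (forall x a u v w, tangent x u -> tangent x v -> tangent x w ->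
         b x (a *: u + v) w = a * b x u w + b x v w),
      (forall x v w, tangent x v -> tangent x w -> b x v w = - b x w v) &
      (forall X Y, vfield X -> vfield Y ->
         smooth_fun (fun x => b x (X x) (Y x)))].

Definition closed_form (b : bform) : Prop :=
  forall X Y Z, vfield X -> vfield Y -> vfield Z -> forall x,
    X x (fun y => b y (Y y) (Z y)) + Y x (fun y => b y (Z y) (X y))
    + Z x (fun y => b y (X y) (Y y))
    - b x (bracket X Y x) (Z x) - b x (bracket Y Z x) (X x)
    - b x (bracket Z X x) (Y x) = 0.

Definition basis_at (x : M) (e : 'I_m -> vec) : Prop :=
  (forall i, tangent x (e i)) /\
  (forall v, tangent x v ->
     exists! a : 'rV[R]_m, v = \sum_i a 0 i *: e i).

(* The value does not depend on the basis e. *)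
Definition trace_at (x : M) (L : vec -> vec) : R :=
  xget 0 [set r | exists (e : 'I_m -> vec) (a : 'M[R]_m),
    [/\ basis_at x e, (forall j, L (e j) = \sum_i a i j *: e i) &
        r = \tr a]].

Definition linear_at (x : M) (L : vec -> vec) : Prop :=
  (forall v, tangent x v -> tangent x (L v)) /\
  (forall a v w, tangent x v -> tangent x w ->
     L (a *: v + w) = a *: L v + L w).

Definition smooth_endo_fam (k : nat) (u : 'rV[R]_k -> endo) : Prop :=
  forall X f, vfield X -> smooth_fun f ->
    smooth_fam (fun z x => u z x (X x) f).

(* The coordinate vector field d/dy_j of the chart c at cinv c y. *)
Definition coord_vec (c : chart R M m) (y : 'rV[R]_m) (j : 'I_m) : vec :=
  fun f => if `[< smooth_fun f >] then 'D_(basis_vec j) (f \o cinv c) y else 0.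

End Smooth.

Section Paths.
Context {R : realType} {M : ptopologicalType} {m : nat}.
Variable A : smooth_structure R M m.

(* Only the restriction of a path to [0,1] is meaningful. *)
Definition mpath := R -> M -> M.

Definition smooth_path (p : mpath) : Prop :=
  smooth_map_fam A (fun z : 'rV[R]_1 => p (z 0 0)).

Definition smooth_path2 (h : R -> mpath) : Prop :=
  smooth_map_fam A (fun z : 'rV[R]_2 => h (z 0 0) (z 0 1)).

(* P is the class of paths under consideration. Homotopies run through P and
   fix both endpoints (paths in P start at Id). *)
Definition homotopic (P : set mpath) (p q : mpath) : Prop :=
  exists h : R -> mpath,
    [/\ smooth_path2 h,
        (forall s, 0 <= s <= 1 -> P (h s)),
        (forall s, 0 <= s <= 1 -> h s 1 = p 1),
        (forall t, 0 <= t <= 1 -> h 0 t = p t) &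
        (forall t, 0 <= t <= 1 -> h 1 t = q t)].

Definition hclass (P : set mpath) (p : mpath) : set mpath :=
  [set q | homotopic P p q].

Definition univ_cover (P : set mpath) : set (set mpath) :=
  [set a | exists2 p, P p & a = hclass P p].

Definition cover_mul (P : set mpath) (a b : set mpath) : set mpath :=
  [set r | exists p q,
    [/\ a p, b q & homotopic P (fun t => p t \o q t) r]].

Definition cover_pow (P : set mpath) (a : set mpath) (k : nat) : set mpath :=
  iter k (cover_mul P a) (hclass P (fun _ => id)).

Definition conj_path (psi : M -> M) (p : mpath) : mpath :=
  fun t => psi \o p t \o finv psi.

Definition conj_class (psi : M -> M) (a : set mpath) : set mpath :=
  [set conj_path psi p | p in a].

(* Conjugation by a class b of paths acts through the common endpoint of the
   paths in b. *)
Definition conj_class_cover (b a : set mpath) : set mpath :=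
  [set r | exists psi p, [/\ b psi, a p & r = conj_path (psi 1) p]].

End Paths.

Definition borel (M : ptopologicalType) := g_sigma_algebraType (@open M).

Section Symplectic.
Context {R : realType} {M : ptopologicalType} {n : nat}.
Variable A : smooth_structure R M (n + n).
Variable om : @bform R M.

Local Notation vec := (@vec R M).
Local Notation endo := (@endo R M).
Local Notation bform := (@bform R M).
Local Notation mpath := (@mpath R M).
Local Notation tangent := (tangent A).
Local Notation vfield := (vfield A).
Local Notation smooth_fun := (smooth_fun A).

Definition symplectic : Prop :=
  [/\ two_form A om, closed_form A om &
      forall x v, tangent x v -> (forall w, tangent x w -> om x v w = 0) ->
        v = 0].

(* Wedge product of the n two-forms b i, evaluated on the 2n vectors
   v (0, false), v (0, true), v (1, false), v (1, true), ... *)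
Definition wedge (b : 'I_n -> vec -> vec -> R) (v : 'I_n * bool -> vec) : R :=
  (2 ^+ n)^-1 * \sum_(s : {perm ('I_n * bool)})
    (-1) ^+ odd_perm s * \prod_(i < n) b i (v (s (i, false))) (v (s (i, true))).

(* |om^n| on the coordinate frame of the chart c. *)
Definition density (c : chart R M (n + n)) (y : 'rV[R]_(n + n)) : R :=
  `| wedge (fun _ => om (cinv c y))
       (fun ib => coord_vec A c y
          (if ib.2 then rshift n ib.1 else lshift n ib.1)) |.

(* mu is the Borel measure defined by the volume form om^n; M is oriented by
   om^n. *)
Definition liouville (mu : {measure set (borel M) -> \bar R}) : Prop :=
  forall c, atlas A c -> forall B : set (borel M), measurable B -> B `<=` cdom c ->
    mu B = int_rV (fun y => (\1_(cmap c @` B) y * density c y)%:E).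

Definition Symp : set (M -> M) := [set psi | diffeo A psi /\
  forall x v w, tangent x v -> tangent x w ->
    om (psi x) (dmap psi v) (dmap psi w) = om x v w].

Definition symp_path : set mpath := [set p |
  [/\ smooth_path A p, p 0 = id & forall t, 0 <= t <= 1 -> Symp (p t)]].

(* The universal cover of (the identity component of) Symp(M, om). *)
Definition Symp_tilde : set (set mpath) := univ_cover A symp_path.

Section WithMeasure.
Variable mu : {measure set (borel M) -> \bar R}.

Definition intM (f : borel M -> R) : R := Rintegral mu setT f.

(* p is generated by the normalized Hamiltonian H: d/dt p_t = X_t o p_t with
   i_(X_t) om = - dH_t. The endpoints t = 0, 1 follow by continuity. *)
Definition ham_isotopy (p : mpath) (H : R -> M -> R) : Prop :=
  [/\ smooth_path A p /\ (forall t, 0 <= t <= 1 -> diffeo A (p t)), p 0 = id,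
      smooth_fam A (fun z : 'rV[R]_1 => H (z 0 0)),
      (forall t, 0 <= t <= 1 -> intM (H t) = 0) &
      exists X : R -> M -> vec, forall t, 0 < t < 1 ->
        [/\ vfield (X t),
            (forall x f, smooth_fun f ->
               is_derive t 1 (fun s => f (p s x)) (X t (p t x) f)) &
            (forall x v, tangent x v -> om x (X t x) v = - v (H t))]].

(* Paths in Ham(M, om) from Id are the Hamiltonian isotopies. *)
Definition ham_path : set mpath := [set p | exists H, ham_isotopy p H].

Definition Ham_tilde : set (set mpath) := univ_cover A ham_path.

(* The fibre S_x; cx_tangent x j is its tangent space at j, obtained by
   linearizing j^2 = -1 and om (j u) (j v) = om u v. *)
Definition cx_struct (x : M) (j : vec -> vec) : Prop :=
  [/\ linear_at A x j,
      (forall v, tangent x v -> j (j v) = - v),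
      (forall v w, tangent x v -> tangent x w -> om x (j v) (j w) = om x v w) &
      (forall v, tangent x v -> v <> 0 -> 0 < om x v (j v))].

Definition cx_tangent (x : M) (j a : vec -> vec) : Prop :=
  [/\ linear_at A x a,
      (forall v, tangent x v -> a (j v) + j (a v) = 0) &
      (forall v w, tangent x v -> tangent x w ->
         om x (a v) (j w) + om x (j v) (a w) = 0)].

(* The metric of S_x is a multiple of the restriction of the flat bilinear form
   trace (a b) on End(T_x M), so that its Levi-Civita covariant derivative is
   the tangential part of the derivative in End(T_x M): the geodesic equation
   D/dt c' = 0 says that c'' is trace-orthogonal to the tangent space. *)
Definition geodesic (x : M) (c : R -> vec -> vec) : Prop :=
  [/\ (forall t, 0 <= t <= 1 -> cx_struct x (c t)),
      (forall v f, tangent x v -> smooth_fun f ->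
         smooth_fam A (fun (z : 'rV[R]_1) _ => c (z 0 0) v f)) &
      (forall t b, 0 < t < 1 -> cx_tangent x (c t) b ->
         trace_at A x
           ((fun v f => derive1n 2 (fun s => c s v f) t) \o b) = 0)].

Definition calJ : set endo := [set J |
  (forall x, cx_struct x (J x)) /\ smooth_endo_fam A (fun _ : 'rV[R]_0 => J)].

Definition eq_endo (J J' : endo) : Prop :=
  forall x v, tangent x v -> J x v = J' x v.

Definition push (phi : M -> M) (J : endo) : endo :=
  fun y w => dmap phi (J (finv phi y) (dmap (finv phi) w)).

Definition geodesic_path (J0 J1 : endo) (c : R -> endo) : Prop :=
  [/\ forall x, geodesic x (fun t => c t x), eq_endo (c 0) J0 &
      eq_endo (c 1) J1].

Definition Omega (J a b : endo) : R :=
  intM (fun x => 4^-1 * trace_at A x (J x \o a x \o b x)).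

(* A disk filling the loop {p_t J0} # [p_1 J0, J0], parametrized by (s, t) in
   the unit square: s = 0 is the path {p_t J0}, s = 1 is the geodesic path from
   J0 to p_1 J0, and the sides t = 0 and t = 1 are constant. *)
Definition filling (J0 : endo) (p : mpath) (u : R -> R -> endo) : Prop :=
  [/\ smooth_endo_fam A (fun z : 'rV[R]_2 => u (z 0 0) (z 0 1)),
      (forall s t, 0 <= s <= 1 -> 0 <= t <= 1 -> calJ (u s t)),
      (forall t, 0 <= t <= 1 -> eq_endo (u 0 t) (push (p t) J0)),
      (forall s, 0 <= s <= 1 ->
         eq_endo (u s 0) J0 /\ eq_endo (u s 1) (push (p 1) J0)) &
      geodesic_path J0 (push (p 1) J0) (u 1)].

(* The integral of Omega over the disk; the boundary traverses {p_t J0} forward,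
   hence the disk is oriented by (d/dt, d/ds). *)
Definition area (u : R -> R -> endo) : R :=
  let du_s s t : endo := fun x v f => derive1 (fun s' => u s' t x v f) s in
  let du_t s t : endo := fun x v f => derive1 (fun t' => u s t' x v f) t in
  Rintegral (@lebesgue_measure R) `[0, 1] (fun s =>
    Rintegral (@lebesgue_measure R) `[0, 1] (fun t =>
      Omega (u s t) (du_t s t) (du_s s t))).

Definition applyJ (J : endo) (X : M -> vec) : M -> vec := fun x => J x (X x).

(* h(J) = g(J) - i om with g(J)(v, w) = om (v, J w). *)
Definition herm (J : endo) (x : M) (v w : vec) : R[i] :=
  Complex (om x v (J x w)) (- om x v w).

Definition dirC (v : vec) (f : M -> R[i]) : R[i] :=
  Complex (v (fun y => complex.Re (f y))) (v (fun y => complex.Im (f y))).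

Definition connection (nab : (M -> vec) -> (M -> vec) -> M -> vec) : Prop :=
  [/\ (forall X Y, vfield X -> vfield Y -> vfield (nab X Y)),
      (forall f X X' Y, smooth_fun f -> vfield X -> vfield X' -> vfield Y ->
         nab (smul f X + X') Y = smul f (nab X Y) + nab X' Y),
      (forall X Y Y', vfield X -> vfield Y -> vfield Y' ->
         nab X (Y + Y') = nab X Y + nab X Y') &
      (forall f X Y, smooth_fun f -> vfield X -> vfield Y ->
         nab X (smul f Y) = smul (fun x => X x f) Y + smul f (nab X Y))].

Definition torsion (nab : (M -> vec) -> (M -> vec) -> M -> vec)
    (X Y : M -> vec) : M -> vec :=
  nab X Y - nab Y X - bracket X Y.

(* In the last clause, the (1,1) part of the torsion T is its J-invariant part
   (T(X,Y) + T(JX,JY)) / 2. *)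
Definition canonical_connection (J : endo)
    (nab : (M -> vec) -> (M -> vec) -> M -> vec) : Prop :=
  [/\ connection nab,
      (forall X Y, vfield X -> vfield Y ->
         nab X (applyJ J Y) = applyJ J (nab X Y)),
      (forall X Y Z, vfield X -> vfield Y -> vfield Z -> forall x,
         dirC (X x) (fun y => herm J y (Y y) (Z y)) =
         herm J x (nab X Y x) (Z x) + herm J x (Y x) (nab X Z x)) &
      (forall X Y, vfield X -> vfield Y ->
         torsion nab X Y + torsion nab (applyJ J X) (applyJ J Y) = 0)].

Definition curvature (nab : (M -> vec) -> (M -> vec) -> M -> vec)
    (X Y Z : M -> vec) : M -> vec :=
  nab X (nab Y Z) - nab Y (nab X Z) - nab (bracket X Y) Z.

Definition upd (T : Type) (v : 'I_n -> T) (j : 'I_n) (w : T) : 'I_n -> T :=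
  fun k => if k == j then w else v k.

(* The dual of Lambda^n_C (T_x M, J): alternating J-complex n-linear forms. *)
Definition cvol_form (J : endo) (x : M) (al : ('I_n -> vec) -> R[i]) : Prop :=
  forall v : 'I_n -> vec, (forall k, tangent x (v k)) ->
  [/\ (forall j a w w', tangent x w -> tangent x w' ->
         al (upd v j (a *: w + w')) =
         Complex a 0 * al (upd v j w) + al (upd v j w')),
      (forall j, al (upd v j (J x (v j))) = Complex 0 1 * al v) &
      (forall j k, j != k -> v j = v k -> al v = 0)].

(* i rho is the curvature of the connection induced by nab on
   Lambda^n_C (TM, J): the curvature operator F(X,Y) of the induced connection
   maps Z_1 /\ ... /\ Z_n to the sum over j of
   Z_1 /\ ... /\ R(X,Y) Z_j /\ ... /\ Z_n. *)
Definition ricci_form (J : endo)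
    (nab : (M -> vec) -> (M -> vec) -> M -> vec) (rho : bform) : Prop :=
  [/\ two_form A rho, closed_form A rho &
      forall X Y (Z : 'I_n -> M -> vec), vfield X -> vfield Y ->
        (forall k, vfield (Z k)) -> forall x al, cvol_form J x al ->
        \sum_j al (upd (fun k => Z k x) j (curvature nab X Y (Z j) x)) =
        Complex 0 (rho x (X x) (Y x)) * al (fun k => Z k x)].

(* S(J) om^n = n rho /\ om^(n-1). *)
Definition scal (J : endo) : M -> R := fun x => xget 0 [set r |
  exists nab rho, [/\ canonical_connection J nab, ricci_form J nab rho &
    forall v, (forall i, tangent x (v i)) ->
      r * wedge (fun _ => om x) v =
      n%:R * wedge (fun i => if i == 0%N :> nat then rho x else om x) v]].

Definition moment (H : M -> R) (J : endo) : R := intM (fun x => scal J x * H x).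

(* The value of S_(J0) on the class a: it is computed from any representative
   p of a, with its normalized Hamiltonian H, and any filling disk u. *)
Definition frakS_at (J0 : endo) (a : set mpath) : R :=
  xget 0 [set r | exists p H u,
    [/\ a p, ham_isotopy p H, filling J0 p u &
        r = area u - Rintegral (@lebesgue_measure R) `[0, 1]
                       (fun t => moment (H t) (push (p t) J0))]].

(* S(a) = lim_k S_(J0)(a^k) / k, the limit being independent of J0. Only the
   values of S on Ham_tilde are meaningful. *)
Definition is_frakS (S : set mpath -> R) : Prop :=
  forall J0, calJ J0 -> forall a, Ham_tilde a ->
    (fun k : nat => (k%:R)^-1 * frakS_at J0 (cover_pow A ham_path a k)) @ \oo
      --> S a.

End WithMeasure.
End Symplectic.

(* Main.v *)
Require Import Defs.
From HB Require Import structures.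
From mathcomp Require Import all_boot all_order all_algebra.
From mathcomp Require Import all_classical all_reals all_analysis.
From mathcomp Require Import complex.

(* Everything that enters S is natural under a symplectomorphism psi:
   transporting the path, its Hamiltonian, the complex structure J and the
   filling disk by psi changes neither the area nor the moment map term, so that
   S_(psi_* J)(psi a psi^-1) = S_J(a). Conjugation by psi commutes with powers,
   and the limit defining S does not depend on J; hence S(psi a psi^-1) = S(a).
   A class of paths in Symp acts through the common endpoint of its paths. *)

Local Open Scope classical_set_scope.
Local Open Scope ring_scope.

Set Implicit Arguments.
Unset Strict Implicit.
Unset Printing Implicit Defensive.

Import Order.TTheory GRing.Theory Num.Theory.
Import numFieldNormedType.Exports.

(* [fingraph] exports another [finv]. *)
Local Notation finv := Defs.finv.

(** * Functions of class C^k *)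

(** Traces, scalar curvature and the value of [frakS_at] are picked by [xget] from sets of
    admissible values, so naturality takes the form of an equality of those sets. Transport proves
    one inclusion, and the other is the same inclusion for the inverse map; for the sake of this
    symmetry transport is written with an explicit pair [g], [g'] of mutually inverse maps in place
    of [finv]. The hypothesis [liouville] describes the measure only inside single charts, and
    compactness of M is what turns this into global invariance. *)

Section CkTheory.
Context {R : realType}.
Implicit Types (N k : nat).

Lemma Ck_continuous N k (U : set 'rV[R]_N) f x :
  Ck k U f -> U x -> {for x, continuous f}.
Proof. by case: k => [|k] [+ _]; apply. Qed.

Lemma Ck_subset N k (U V : set 'rV[R]_N) f : V `<=` U -> Ck k U f -> Ck k V f.
Proof.
move=> VU; elim: k f => [|k IH] f [cf df]; split=> [x /VU /cf //|] // i.
by have [dfi Cfi] := df i; split=> [x /VU /dfi //|]; exact: IH.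
Qed.

Lemma Ck_succ N k (U : set 'rV[R]_N) f : Ck k.+1 U f -> Ck k U f.
Proof.
elim: k f => [|k IH] f [cf df]; split=> // i.
by have [dfi /IH Cfi] := df i.
Qed.

Lemma near_eq_continuous (T : topologicalType) (f g : T -> R) x :
  (\near x, f x = g x) -> {for x, continuous g} -> {for x, continuous f}.
Proof.
move=> fg; rewrite /prop_for /continuous_at (nbhs_singleton fg).
by apply: cvg_trans; apply: near_eq_cvg; near do apply/esym.
Unshelve. all: by end_near. Qed.

(** Partial derivatives depend only on the germ, so a different local representative may be used
    near each point. *)
Lemma Ck_local N k (U : set 'rV[R]_N) f :
  (forall x, U x -> exists V g,
     [/\ open V, V x, Ck k V g & forall y, V y -> f y = g y]) ->
  Ck k U f.
Proof.
have nearV (V : set 'rV[R]_N) (g h : 'rV[R]_N -> R) y : open V -> V y ->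
    (forall z, V z -> h z = g z) -> \near y, h y = g y.
  by move=> oV Vy hg; apply: filterS (open_nbhs_nbhs (conj oV Vy)) => z /hg.
elim: k f => [|k IH] f Uf; (split=> [x Ux|];
  first by have [V [g [oV Vx Cg fg]]] := Uf x Ux;
    apply: near_eq_continuous (nearV V g f x oV Vx fg) (Ck_continuous Cg Vx)).
  by [].
move=> i; split=> [x Ux|].
  have [V [g [oV Vx [_ /(_ i)[dg _]] fg]]] := Uf x Ux.
  apply: near_eq_derivable (dg x Vx).
  by apply: (nearV V f g x) => // z Vz; rewrite fg.
apply: IH => x Ux; have [V [g [oV Vx [_ /(_ i)[_ Cg]] fg]]] := Uf x Ux.
exists V, (fun y => 'D_(basis_vec i) g y); split=> // y Vy.
exact: near_eq_derive (nearV V g f y oV Vy fg).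
Qed.

Lemma Ck_eq N k (U : set 'rV[R]_N) f g :
  open U -> (forall x, U x -> f x = g x) -> Ck k U g -> Ck k U f.
Proof. by move=> oU fg Cg; apply: Ck_local => x Ux; exists U, g. Qed.

Lemma Ck_linear N k (U : set 'rV[R]_N) a f g :
  open U -> Ck k U f -> Ck k U g -> Ck k U (fun x => a * f x + g x).
Proof.
move=> oU; elim: k f g => [|k IH] f g [cf df] [cg dg].
  split=> // x Ux; apply: continuousD; last exact: cg.
  by apply: continuousM; [exact: cst_continuous|exact: cf].
split=> [x Ux|i].
  apply: continuousD; last exact: cg.
  by apply: continuousM; [exact: cst_continuous|exact: cf].
have [dfi Cfi] := df i; have [dgi Cgi] := dg i; split=> [x Ux|].
  by apply: derivableD (dgi x Ux); apply: derivableZ (dfi x Ux).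
apply: Ck_eq (IH _ _ Cfi Cgi) => // x Ux.
have -> : (fun x => a * f x + g x) = (a *: f) + g by [].
rewrite deriveD; [|by apply: derivableZ (dfi x Ux)|exact: dgi].
by rewrite deriveZ //; exact: dfi.
Qed.

Lemma Ck_mul N k (U : set 'rV[R]_N) f g :
  open U -> Ck k U f -> Ck k U g -> Ck k U (fun x => f x * g x).
Proof.
move=> oU; elim: k f g => [|k IH] f g Cf Cg.
  by split=> // x Ux; apply: continuousM; [exact: Cf.1|exact: Cg.1].
have [cf df] := Cf; have [cg dg] := Cg.
split=> [x Ux|i]; first by apply: continuousM; [exact: cf|exact: cg].
have [dfi Cfi] := df i; have [dgi Cgi] := dg i; split=> [x Ux|].
  by apply: derivableM; [exact: dfi|exact: dgi].
(* Each term of the Leibniz rule has one undifferentiated factor; [Ck_succ] lowers its order to [k]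
   to match the induction hypothesis. *)
have /(Ck_linear 1 oU (IH _ _ (Ck_succ Cf) Cgi)) : Ck k U
    (fun x => g x * 'D_(basis_vec i) f x) by exact: IH (Ck_succ Cg) Cfi.
apply: Ck_eq => // x Ux; rewrite mul1r.
have -> : (fun x => f x * g x) = f * g by [].
by rewrite deriveM //; [exact: dfi|exact: dgi].
Qed.

Lemma Ck_cst N k (U : set 'rV[R]_N) (a : R) : Ck k U (fun _ => a).
Proof.
elim: k a => [|k IH] a; (split=> [x _|]; first exact: cst_continuous) => //.
move=> i; split=> [x _|]; first exact: derivable_cst.
have -> : (fun x : 'rV[R]_N => 'D_(basis_vec i) (fun _ => a) x) = fun _ => 0.
  by apply/funext => x; rewrite derive_cst.
exact: IH.
Qed.

(* The hypothesis on [L] says that it is a coordinate projection, up to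
   repetitions of coordinates; it spares the chain rule. *)
Lemma Ck_comp_proj N N' k (U : set 'rV[R]_N') (L : {linear 'rV[R]_N -> 'rV[R]_N'}) f :
  open U -> continuous L ->
  (forall i, L (basis_vec i) = 0 \/ exists j, L (basis_vec i) = basis_vec j) ->
  Ck k U f -> Ck k (L @^-1` U) (f \o L).
Proof.
move=> oU cL Lb.
have oLU : open (L @^-1` U) by move/continuousP: cL; apply.
(* By linearity the difference quotient of [g \o L] along [v] is that of [g] along [L v], which is a
   partial derivative of [g] or zero when [v] is a basis vector. *)
have quot g (x v : 'rV[R]_N) :
    (fun h : R => h^-1 *: (((g \o L) \o shift x) (h *: v) - (g \o L) x)) =
    (fun h => h^-1 *: ((g \o shift (L x)) (h *: L v) - g (L x))).
  by apply/funext => h /=; rewrite (linearD L) (linearZ_LR L).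
elim: k f => [|k IH] f Cf.
  by split=> // x Ux; apply: continuous_comp (cL x) _; exact: Cf.1.
have [cf df] := Cf; split=> [x Ux|i].
  by apply: continuous_comp (cL x) _; exact: cf.
have [Li|[j Li]] := Lb i; last first.
  have [dfj Cfj] := df j; split=> [x Ux|].
    by rewrite /derivable quot Li; exact: dfj.
  apply: Ck_eq (IH _ Cfj) => // x Ux /=.
  by rewrite /derive quot Li.
have D0 x : derivable f x 0 /\ 'D_0 f x = 0 :> R.
  have : (fun h => h^-1 *: ((f \o shift x) (h *: 0) - f x)) =
    (fun=> 0) :> (R -> R).
    by apply/funext => h /=; rewrite scaler0 add0r subrr scaler0.
  rewrite /derivable /derive => ->; split; first exact: is_cvg_cst.
  exact: lim_cst.
split=> [x Ux|].
  by rewrite /derivable quot Li; exact: (D0 _).1.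
apply: Ck_eq (Ck_cst k _ 0) => // x Ux; rewrite /derive quot Li.
exact: (D0 _).2.
Qed.

End CkTheory.

(** * Transport of smoothness along diffeomorphisms *)

(** A neighbourhood of a matrix contains a box of entrywise neighbourhoods, and finitely many
    entrywise conditions hold simultaneously near [x]. *)
Lemma continuous_rV (R : realType) (T : topologicalType) N (F : T -> 'rV[R]_N) x :
  (forall j, {for x, continuous (fun y => F y 0 j)}) -> {for x, continuous F}.
Proof.
move=> cF B [P PF PB].
have : \forall y \near x, forall ij : 'I_1 * 'I_N, P ij.1 ij.2 (F y ij.1 ij.2).
  apply: filter_forall => -[i j] /=; rewrite (ord1 i).
  exact: (cF j _ (PF 0 j)).
by apply: filterS => y Py; apply: PB => i j; exact: (Py (i, j)).
Qed.

Lemma finv_eq (M : ptopologicalType) (f g : M -> M) :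
  cancel f g -> cancel g f -> finv f = g.
Proof.
move=> fK gK; apply/funext => y; rewrite /finv.
by case: xgetP => [x _ /= <-|/(_ (g y))]; [rewrite fK|rewrite /= gK].
Qed.

Section SmoothTransport.
Context {R : realType} {M : ptopologicalType} {m : nat}.
Variable A : smooth_structure R M m.
Implicit Types (f g : M -> M) (c d : chart R M m).

Lemma finvK f : bijective f -> cancel f (finv f).
Proof. by move=> [g fK gK]; rewrite (finv_eq fK gK). Qed.

Lemma finvKV f : bijective f -> cancel (finv f) f.
Proof. by move=> [g fK gK]; rewrite (finv_eq fK gK). Qed.

Lemma cimg_open c : atlas A c -> open (cimg c).
Proof. by move=> /(atlas_chart (s := A)) []. Qed.

Lemma cdom_open c : atlas A c -> open (cdom c).
Proof. by move=> /(atlas_chart (s := A)) []. Qed.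

Lemma cinvK c x : atlas A c -> cdom c x -> cinv c (cmap c x) = x.
Proof. by move=> /(atlas_chart (s := A)) [_ _ + _ _] => /[apply]. Qed.

Lemma cimgP c y : atlas A c -> cimg c y -> cdom c (cinv c y) /\ cmap c (cinv c y) = y.
Proof. by move=> Ac [x cx <-]; rewrite (cinvK Ac cx). Qed.

Lemma cimg_cmap c x : cdom c x -> cimg c (cmap c x).
Proof. by exists x. Qed.

Lemma cube0 : @cube R 0 0.
Proof. by case. Qed.

(** The parameter space is R^0, so the empty block of [row_mx] disappears; shrinking to the open
    chart image makes the local formula valid on all of [U]. *)
Lemma smooth_map_in_charts f x c d : smooth_map A f ->
  atlas A c -> atlas A d -> cdom c x -> cdom d (f x) ->
  exists (U : set 'rV[R]_m) (G : 'rV[R]_m -> 'rV[R]_m),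
    [/\ open U, U (cmap c x), U `<=` cimg c, Cinf_map U G &
        forall y, U y ->
          cdom d (f (cinv c y)) /\ cmap d (f (cinv c y)) = G y].
Proof.
move=> sf Ac Ad cx dfx.
have [U [G [oU Ux CG eG]]] := sf 0 x c d cube0 Ac Ad cx dfx.
rewrite row_thin_mx in Ux.
exists (U `&` cimg c), G; split.
- by apply: openI => //; exact: cimg_open.
- by split=> //; exact: cimg_cmap.
- by move=> y [].
- by move=> j k; apply: Ck_subset (CG j k) => y [].
- move=> y [Uy cy]; have := eG 0 y; rewrite row_thin_mx; apply => //; exact: cube0.
Qed.

(** The local representation keeps [f] inside the target chart, so near [x] the map equals
    [cinv d \o (G \o cmap c)], a composite of continuous maps. *)
Lemma smooth_map_continuous f : smooth_map A f -> continuous f.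
Proof.
move=> sf x; have [c Ac cx] := atlas_cover A x.
have [d Ad dfx] := atlas_cover A (f x).
have [U [G [oU Ux Uc CG eG]]] := smooth_map_in_charts sf Ac Ad cx dfx.
have [_ _ cK ccmap _] := atlas_chart Ac.
have [_ _ dK _ cdinv] := atlas_chart Ad.
have feq y : cdom c y -> U (cmap c y) -> f y = cinv d (G (cmap c y)).
  move=> cy /eG; rewrite cK // => -[dfy <-]; by rewrite dK.
have cG : {for cmap c x, continuous G}.
  by apply: continuous_rV => j; exact: Ck_continuous (CG j 0) Ux.
have Gx : G (cmap c x) = cmap d (f x) by have [_ <-] := eG _ Ux; rewrite cK.
have cont : {for x, continuous (cinv d \o (G \o cmap c))}.
  apply: continuous_comp; first by apply: continuous_comp => //; exact: ccmap.
  by rewrite /= Gx; apply: cdinv; exact: cimg_cmap.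
have nx : \forall y \near x, f y = (cinv d \o (G \o cmap c)) y.
  have nU : \forall y \near x, U (cmap c y).
    by apply: (ccmap x cx); apply: open_nbhs_nbhs.
  have nc : \forall y \near x, cdom c y.
    by apply: open_nbhs_nbhs; split=> //; exact: cdom_open.
  by near=> y; rewrite feq //; near: y.
rewrite /continuous_at (nbhs_singleton nx); apply: cvg_trans cont.
by apply: near_eq_cvg; near do apply/esym.
Unshelve. all: by end_near. Qed.

Definition inverse_diffeos g g' : Prop :=
  [/\ cancel g g', cancel g' g, smooth_map A g & smooth_map A g'].

Lemma inverse_diffeosC g g' : inverse_diffeos g g' -> inverse_diffeos g' g.
Proof. by case. Qed.

Lemma diffeo_inverse g : diffeo A g -> inverse_diffeos g (finv g).
Proof. by move=> [bg sg sg']; split=> //; [exact: finvK|exact: finvKV]. Qed.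

Lemma inverse_diffeos_diffeo g g' : inverse_diffeos g g' -> diffeo A g.
Proof.
by move=> [K K' sg sg']; split; [exists g'|exact: sg|rewrite (finv_eq K K')].
Qed.

(** A function read in this chart has the same expression as its composite with [g] read in [c]. *)
Definition chart_push g g' c : chart R M m :=
  Chart (g' @^-1` cdom c) (cmap c \o g') (g \o cinv c).

Lemma cimg_chart_push g g' c : cancel g g' -> cimg (chart_push g g' c) = cimg c.
Proof.
move=> K; apply/seteqP; split=> y [x cx <-]; first by exists (g' x).
by exists (g x); rewrite /= K.
Qed.

(* Maximality of the atlas turns transport of smoothness along a diffeomorphism
   into a change of charts, so that no chain rule is needed. *)
Lemma atlas_chart_push g g' c :
  inverse_diffeos g g' -> atlas A c -> atlas A (chart_push g g' c).
Proof.
move=> [K K' sg sg'] Ac; have [oc oic cK ccmap ccinv] := atlas_chart Ac.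
have cg := smooth_map_continuous sg; have cg' := smooth_map_continuous sg'.
apply: atlas_max; first split.
- by move/continuousP: cg'; apply.
- by rewrite cimg_chart_push.
- by move=> x cx /=; rewrite cK // K'.
- by move=> x cx; apply: continuous_comp (cg' x) _; exact: ccmap.
- rewrite cimg_chart_push // => y cy; apply: continuous_comp (ccinv y cy) _.
  exact: cg.
(* The two transition maps are the coordinate expressions of [g] and of [g'], smooth by
   assumption. *)
move=> d Ad; split=> j k; apply: Ck_local => _ [x [/= cx dx] <-].
  have dgx : cdom d (g (g' x)) by rewrite K'.
  have [U [G [oU Ux Uc CG eG]]] := smooth_map_in_charts sg Ac Ad cx dgx.
  by exists U, (fun y => G y 0 j);
    split=> [||| y Uy] //=; [exact: CG|rewrite (eG y Uy).2].
have [U [G [oU Ux Uc CG eG]]] := smooth_map_in_charts sg' Ad Ac cx dx.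
by exists U, (fun y => G y 0 j);
    split=> [||| y Uy] //=; [exact: CG|rewrite (eG y Uy).2].
Qed.

(** Reading [F z \o g'] in [c] is reading [F z] in [chart_push g' g c], so the same local extension
    serves. *)
Lemma smooth_fam_comp k (F : 'rV[R]_k -> M -> R) g g' :
  inverse_diffeos g g' -> smooth_fam A F -> smooth_fam A (fun z => F z \o g').
Proof.
move=> gg' sF z x c Cz Ac cx; have [K K' _ _] := gg'.
have Ae := atlas_chart_push (inverse_diffeosC gg') Ac.
have ex : cdom (chart_push g' g c) (g' x) by rewrite /= K'.
have [U [h [oU Ux Ch eh]]] := sF z (g' x) _ Cz Ae ex.
exists U, h; split=> //; first by move: Ux; rewrite /= K'.
by move=> z' y Uy Cz' cy; apply: eh => //; rewrite cimg_chart_push.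
Qed.

Lemma smooth_map_fam_conj k (F : 'rV[R]_k -> M -> M) g g' :
  inverse_diffeos g g' -> smooth_map_fam A F ->
  smooth_map_fam A (fun z => g \o F z \o g').
Proof.
move=> gg' sF z x c d Cz Ac Ad cx dx; have [K K' _ _] := gg'.
have Ae := atlas_chart_push (inverse_diffeosC gg') Ac.
have Ae' := atlas_chart_push (inverse_diffeosC gg') Ad.
have ex : cdom (chart_push g' g c) (g' x) by rewrite /= K'.
have [U [h [oU Ux Ch eh]]] := sF z (g' x) _ _ Cz Ae Ae' ex dx.
exists U, h; split=> //; first by move: Ux; rewrite /= K'.
by move=> z' y Uy Cz' cy; apply: eh => //; rewrite cimg_chart_push.
Qed.

Lemma inverse_diffeos_conj p g g' : diffeo A p -> inverse_diffeos g g' ->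
  inverse_diffeos (g \o p \o g') (g \o finv p \o g').
Proof.
move=> [bp sp sp'] gg'; have [K K' _ _] := gg'; split.
- by move=> x /=; rewrite K finvK.
- by move=> x /=; rewrite K finvKV.
- exact: smooth_map_fam_conj gg' sp.
- exact: smooth_map_fam_conj gg' sp'.
Qed.

(** The converse direction is what makes [dmap g v] vanish on non-smooth functions, as [tangent]
    demands. *)
Lemma smooth_fun_comp g g' (h : M -> R) :
  inverse_diffeos g g' -> smooth_fun A h <-> smooth_fun A (h \o g).
Proof.
move=> gg'; have [K K' _ _] := gg'; split.
  by move/(smooth_fam_comp (inverse_diffeosC gg')).
move/(smooth_fam_comp gg'); rewrite /smooth_fun /=.
by congr smooth_fam; apply/funext => _; apply/funext => x /=; rewrite K'.
Qed.

Lemma smooth_fun_linear a (f g : M -> R) : smooth_fun A f -> smooth_fun A g ->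
  smooth_fun A (fun x => a * f x + g x).
Proof.
move=> sf sg z x c Cz Ac cx.
have [U [h [oU Ux Ch eh]]] := sf z x c Cz Ac cx.
have [V [l [oV Vx Cl el]]] := sg z x c Cz Ac cx.
exists (U `&` V), (fun y => a * h y + l y); split=> //.
- exact: openI.
- move=> k; apply: Ck_linear; first exact: openI.
    by apply: Ck_subset (Ch k) => y [].
  by apply: Ck_subset (Cl k) => y [].
- by move=> z' y [Uy Vy] Cz' cy; rewrite (eh z') // (el z').
Qed.

Lemma smooth_fun_mul (f g : M -> R) : smooth_fun A f -> smooth_fun A g ->
  smooth_fun A (fun x => f x * g x).
Proof.
move=> sf sg z x c Cz Ac cx.
have [U [h [oU Ux Ch eh]]] := sf z x c Cz Ac cx.
have [V [l [oV Vx Cl el]]] := sg z x c Cz Ac cx.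
exists (U `&` V), (fun y => h y * l y); split=> //.
- exact: openI.
- move=> k; apply: Ck_mul; first exact: openI.
    by apply: Ck_subset (Ch k) => y [].
  by apply: Ck_subset (Cl k) => y [].
- by move=> z' y [Uy Vy] Cz' cy; rewrite (eh z') // (el z').
Qed.

Lemma smooth_fun_derivable (f : M -> R) c y i :
  smooth_fun A f -> atlas A c -> cimg c y ->
  derivable (f \o cinv c) y (@basis_vec R m i).
Proof.
move=> sf Ac cy; have [cx cE] := cimgP Ac cy.
have [U [h [oU Ux Ch eh]]] := sf 0 (cinv c y) c cube0 Ac cx.
rewrite row_thin_mx cE in Ux.
have [_ /(_ i) [dh _]] := Ch 1.
apply: near_eq_derivable (dh y Ux).
have : nbhs y (U `&` cimg c).
  by apply: open_nbhs_nbhs; split=> //; apply: openI => //; exact: cimg_open.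
apply: filterS => w [Uw cw].
by have := eh 0 w; rewrite row_thin_mx => <- //; exact: cube0.
Qed.

(** Preservation of [om] is stated for tangent vectors, so the comparison of densities requires the
    coordinate frame to be tangent. *)
Lemma tangent_coord_vec c y i : atlas A c -> cimg c y ->
  tangent A (cinv c y) (coord_vec A c y i).
Proof.
move=> Ac cy; split=> [a f g sf sg|f g sf sg|f nf]; rewrite /coord_vec.
- rewrite !asboolT //; last exact: smooth_fun_linear.
  have df := smooth_fun_derivable (i := i) sf Ac cy.
  have dg := smooth_fun_derivable (i := i) sg Ac cy.
  rewrite [X in 'D_ _ X _](_ : _ = a *: (f \o cinv c) + (g \o cinv c)) //.
  by rewrite (deriveD (derivableZ df) dg) (deriveZ _ df).
- rewrite !asboolT //; last exact: smooth_fun_mul.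
  have df := smooth_fun_derivable (i := i) sf Ac cy.
  have dg := smooth_fun_derivable (i := i) sg Ac cy.
  rewrite [X in 'D_ _ X _](_ : _ = (f \o cinv c) * (g \o cinv c)) //.
  by rewrite (deriveM df dg) addrC [X in X + _]mulrC.
- by rewrite asboolF.
Qed.

Lemma coord_vec_chart_push g g' c y i : inverse_diffeos g g' ->
  coord_vec A (chart_push g g' c) y i = dmap g (coord_vec A c y i).
Proof.
move=> gg'; apply/funext => f; rewrite /coord_vec /dmap.
by rewrite (asbool_equiv_eq (smooth_fun_comp f gg')).
Qed.

Lemma tangent_dmap g g' x v : inverse_diffeos g g' ->
  tangent A x v -> tangent A (g x) (dmap g v).
Proof.
move=> gg' [vD vM v0]; have sE h := smooth_fun_comp h gg'.
split=> [a f h /sE sf /sE sh|f h /sE sf /sE sh|f /sE nf]; rewrite /dmap.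
- exact: vD sf sh.
- exact: vM sf sh.
- exact: v0.
Qed.

End SmoothTransport.

(** * Invariance of the Liouville measure *)

Section MeasurePreserving.
Context d (T : measurableType d) (R : realType).
Import HBSimple HBNNSimple.
Local Open Scope ereal_scope.

Lemma nnsfun_comp (h : {nnsfun T >-> R}) (f : T -> T) :
  measurable_fun setT f -> exists h' : {nnsfun T >-> R}, h' = h \o f :> (T -> R).
Proof.
move=> mf.
have mhf : measurable_fun setT (h \o f) by apply: measurableT_comp.
have fhf : finite_set (range (h \o f)).
  by apply: sub_finite_set (fimfunP h) => _ [x _ <-]; exists (f x).
have phf x : (0 <= (h \o f) x)%R by exact: fun_ge0.
pose k := HB.pack_for {nnsfun T >-> R} (h \o f)
  (isMeasurableFun.Build _ _ _ _ _ mhf) (FiniteImage.Build _ _ _ fhf)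
  (isNonNegFun.Build _ _ _ phf).
by exists k.
Qed.

Variable mu : {measure set T -> \bar R}.

(** The level sets of [h \o f] are the preimages of those of [h] and have the same measure. *)
Lemma sintegral_comp (h : {nnsfun T >-> R}) (f : T -> T) :
  (forall B, measurable B -> mu (f @^-1` B) = mu B) ->
  sintegral mu (h \o f) = sintegral mu h.
Proof.
move=> fmu; apply: eq_fsbigr => x _; congr (_ * _).
rewrite comp_preimage fmu //; exact: measurable_funPTI.
Qed.

Let nnint (F : T -> \bar R) := ereal_sup [set sintegral mu h |
  h in [set h : {nnsfun T >-> R} | forall x, (h x)%:E <= F x]].

Let le_nnint_comp (F : T -> \bar R) (f : T -> T) : measurable_fun setT f ->
  (forall B, measurable B -> mu (f @^-1` B) = mu B) ->
  nnint F <= nnint (F \o f).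
Proof.
move=> mf fmu; apply: ge_ereal_sup => _ [h /= hF <-].
have [h' h'E] := nnsfun_comp h mf.
apply: ereal_sup_ubound; exists h'; first by move=> x; rewrite h'E; exact: hF.
by rewrite h'E sintegral_comp.
Qed.

(* [F] is not assumed to be measurable: both integrals are suprema over the
   simple functions below [F], which correspond under composition. *)
Lemma integral_comp_automorphism (F : T -> \bar R) (f f' : T -> T) :
  cancel f f' -> cancel f' f -> measurable_fun setT f -> measurable_fun setT f' ->
  (forall B, measurable B -> mu (f @^-1` B) = mu B) ->
  \int[mu]_x F (f x) = \int[mu]_x F x.
Proof.
move=> fK fK' mf mf' fmu.
have f'mu B : measurable B -> mu (f' @^-1` B) = mu B.
  move=> mB; rewrite -fmu; last by rewrite -[X in measurable X]setTI; exact: mf'.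
  by congr (mu _); apply/seteqP; split=> x /=; rewrite fK.
(* The reverse inequality is [le_nnint_comp] for [f'], applied to [G \o f]. *)
have E G : nnint (G \o f) = nnint G.
  apply/eqP; rewrite eq_le le_nnint_comp // andbT.
  have -> : nnint G = nnint ((G \o f) \o f').
    by congr nnint; apply/funext => x /=; rewrite fK'.
  exact: le_nnint_comp.
have Ep : (fun x => F (f x))^\+ = F^\+ \o f := funepos_comp F f.
have En : (fun x => F (f x))^\- = F^\- \o f := funeneg_comp F f.
rewrite [LHS]/integral [RHS]/integral !patch_setT Ep En.
by congr (_ - _); exact: E.
Qed.

Lemma Rintegral_comp_automorphism (F : T -> R) (f f' : T -> T) :
  cancel f f' -> cancel f' f -> measurable_fun setT f -> measurable_fun setT f' ->
  (forall B, measurable B -> mu (f @^-1` B) = mu B) ->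
  Rintegral mu setT (F \o f) = Rintegral mu setT F.
Proof.
move=> fK fK' mf mf' fmu; rewrite /Rintegral; congr fine.
exact: (integral_comp_automorphism (EFin \o F) fK fK').
Qed.

End MeasurePreserving.

Section Liouville.
Context {R : realType} {M : ptopologicalType} {n : nat}.
Variables (A : smooth_structure R M (n + n)) (om : @bform R M).
Variable mu : {measure set (borel M) -> \bar R}.
Implicit Types g : M -> M.

Lemma borel_open (U : set M) : open U -> measurable (U : set (borel M)).
Proof. exact: sub_gen_smallest. Qed.

Lemma continuous_borel g : continuous g ->
  measurable_fun setT (g : borel M -> borel M).
Proof.
move=> cg; apply: (@measurability _ _ (borel M) (borel M) setT g (@open M)) => //.
move=> _ [U oU <-].
by rewrite setTI; apply: borel_open; move/continuousP: cg; apply.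
Qed.

Definition om_preserving g := forall x v w, tangent A x v -> tangent A x w ->
  om (g x) (dmap g v) (dmap g w) = om x v w.

Definition symp_pair g g' := inverse_diffeos A g g' /\ om_preserving g.

(** The coordinate frame of the pushed chart is the image under [dmap g] of the frame of [c]. *)
Lemma density_chart_push g g' c y : symp_pair g g' -> atlas A c -> cimg c y ->
  density A om (chart_push g g' c) y = density A om c y.
Proof.
move=> [gg' gom] Ac cy; rewrite /density /wedge; congr `| _ * _ |.
apply: eq_bigr => s _; congr (_ * _); apply: eq_bigr => i _.
by rewrite !(coord_vec_chart_push _ _ _ gg') gom //; exact: tangent_coord_vec.
Qed.

Hypothesis cM : compact [set: M].
Hypothesis lmu : liouville A om mu.

Let liouville_chart g g' c (B : set (borel M)) : symp_pair g g' -> atlas A c ->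
  measurable B -> B `<=` cdom c -> mu (g' @^-1` B) = mu B.
Proof.
move=> sg Ac mB Bc; have [gg' gom] := sg; have [K K' sgg sgg'] := gg'.
have Ae := atlas_chart_push gg' Ac.
rewrite [RHS](lmu Ac) // (lmu Ae); last 2 first.
- rewrite -[X in measurable X]setTI.
  by apply: continuous_borel => //; exact: smooth_map_continuous sgg'.
- by move=> x; exact: Bc.
congr int_rV; apply/funext => y; congr EFin.
rewrite [X in \1_X](_ : _ = cmap c @` B); last first.
  apply/seteqP; split=> z [x Bx <-]; first by exists (g' x).
  by exists (g x) => /=; rewrite K.
(* Off the chart image the densities are not compared, but there the indicator vanishes. *)
have [cy|ncy] := pselect (cimg c y); first by rewrite (density_chart_push sg).
rewrite indicE memNset ?mul0r //; apply: contra_not ncy => -[x Bx <-].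
by apply: cimg_cmap; exact: Bc.
Qed.

Lemma liouville_invariant g g' (B : set (borel M)) : symp_pair g g' ->
  measurable B -> mu (g' @^-1` B) = mu B.
Proof.
move=> sg; have [[K K' sgg sgg'] gom] := sg.
have mg' (C : set (borel M)) : measurable C -> measurable (g' @^-1` C : set (borel M)).
  move=> mC; rewrite -[X in measurable X]setTI.
  by apply: continuous_borel => //; exact: smooth_map_continuous sgg'.
have [c cP] : {c : M -> chart R M (n + n) & forall x, atlas A (c x) /\ cdom (c x) x}.
  apply: (@choice _ _ (fun x c => atlas A c /\ cdom c x)) => x.
  by have [c] := atlas_cover A x; exists c.
have [s sM] : exists s : seq M, forall x : M, exists2 a, a \in s & cdom (c a) x.
  move: cM; rewrite compact_cover => /(_ M setT (fun a => cdom (c a))).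
  case=> [a _|x _|D' _ D'M]; first exact: cdom_open (cP a).1.
    by exists x => //; exact: (cP x).2.
  by exists (finmap.enum_fset D') => x; have [a aD ax] := D'M x I; exists a.
(* The induction on [s] uses a cover of [B] rather than of M, because it passes to the part of [B]
   outside the first chart. *)
have {sM} : B `<=` [set x | exists2 a, a \in s & cdom (c a) x] by move=> x _; exact: sM.
elim: s B => [|a s IH] B Bs mB.
  by have -> : B = set0 by rewrite -subset0 => x /Bs [].
have Ac : atlas A (c a) := (cP a).1.
have mc : measurable (cdom (c a) : set (borel M)).
  by apply: borel_open; exact: cdom_open Ac.
have BE : B = (B `&` cdom (c a)) `|` (B `\` cdom (c a)) by rewrite setUIDK.
have m1 : measurable (B `&` cdom (c a)) by exact: measurableI.
have m2 : measurable (B `\` cdom (c a)) by exact: measurableD.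
have disj (f : M -> M): f @^-1` (B `&` cdom (c a)) `&` f @^-1` (B `\` cdom (c a)) = set0.
  by rewrite -subset0 => x [[_ cx] [_]].
rewrite BE preimage_setU (measureU mu (mg' _ m1) (mg' _ m2) (disj g')).
rewrite (measureU mu m1 m2 (disj id)); congr (_ + _)%E.
  by apply: liouville_chart sg Ac m1 _ => x [].
apply: IH => // x [/Bs [b + bx] nax]; rewrite inE => /predU1P[ba|bs].
  by rewrite ba in bx.
by exists b.
Qed.

End Liouville.

(** * Transport of the geometric structures *)

Section GeometricTransport.
Context {R : realType} {M : ptopologicalType} {n : nat}.
Variables (A : smooth_structure R M (n + n)) (om : @bform R M).
Implicit Types (g : M -> M) (v w : @vec R M) (X Y Z : M -> @vec R M).
Implicit Types (J : @endo R M) (L : @vec R M -> @vec R M).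

Local Notation vec := (@vec R M).
Local Notation endo := (@endo R M).
Local Notation bform := (@bform R M).
Local Notation connection_op := ((M -> vec) -> (M -> vec) -> M -> vec).

Lemma dmapK g g' v : cancel g' g -> dmap g (dmap g' v) = v.
Proof.
by move=> K'; apply/funext => h; rewrite /dmap; congr v; apply/funext => x /=; rewrite K'.
Qed.

Definition lconj g g' L : vec -> vec := fun w => dmap g (L (dmap g' w)).
Definition endo_push g g' J : endo := fun y => lconj g g' (J (g' y)).
Definition vpush g g' X : M -> vec := fun y => dmap g (X (g' y)).
Definition bpush g g' (b : bform) : bform :=
  fun y v w => b (g' y) (dmap g' v) (dmap g' w).

Lemma pushE g g' J : cancel g g' -> cancel g' g -> push g J = endo_push g g' J.
Proof. by move=> K K'; rewrite /push (finv_eq K K'). Qed.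

Lemma lconjK g g' L : cancel g' g -> lconj g g' (lconj g' g L) = L.
Proof. by move=> K'; apply/funext => w; rewrite /lconj !dmapK. Qed.

Lemma endo_pushK g g' J : cancel g' g -> endo_push g g' (endo_push g' g J) = J.
Proof. by move=> K'; apply/funext => x; rewrite /endo_push K' lconjK. Qed.

Lemma vpushK g g' X : cancel g' g -> vpush g g' (vpush g' g X) = X.
Proof. by move=> K'; apply/funext => x; rewrite /vpush K' dmapK. Qed.

Lemma bracket_vpush g g' X Y : cancel g g' ->
  bracket (vpush g g' X) (vpush g g' Y) = vpush g g' (bracket X Y).
Proof.
move=> K; apply/funext => x; apply/funext => f.
rewrite /bracket /vpush /dmap; congr (X _ _ - Y _ _);
  by apply/funext => y /=; rewrite K.
Qed.

Lemma symp_pairC g g' : symp_pair A om g g' -> symp_pair A om g' g.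
Proof.
move=> [gg' gom]; have g'g := inverse_diffeosC gg'; split=> // x v w tv tw.
have [K K' _ _] := gg'.
rewrite -[in RHS](K' x) -[v in RHS](@dmapK g g') // -[w in RHS](@dmapK g g') // gom //;
  exact: tangent_dmap g'g _.
Qed.

Definition trace_set x L : set R :=
  [set r | exists (e : 'I_(n + n) -> vec) (a : 'M[R]_(n + n)),
    [/\ basis_at A x e, (forall j, L (e j) = \sum_i a i j *: e i) &
        r = \tr a]].

(** * Tangent vectors, the fibres S_x and traces *)

Section Push.
Variables g g' : M -> M.
Hypothesis sg : symp_pair A om g g'.

Let gg' : inverse_diffeos A g g' := sg.1.
Let K : cancel g g'. Proof. by case: gg'. Qed.
Let K' : cancel g' g. Proof. by case: gg'. Qed.
Let g'omE : om_preserving A om g' := (symp_pairC sg).2.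

Lemma tangent_pull y w : tangent A y w -> tangent A (g' y) (dmap g' w).
Proof. exact: tangent_dmap (inverse_diffeosC gg'). Qed.

Lemma tangent_push y v : tangent A (g' y) v -> tangent A y (dmap g v).
Proof. by move/(tangent_dmap gg'); rewrite K'. Qed.

(** [dmap g] and [dmap g'] are adjoint for [om]: preservation by [g'] with one cancellation. *)
Lemma om_pull y v w : tangent A (g' y) v -> tangent A y w ->
  om y (dmap g v) w = om (g' y) v (dmap g' w).
Proof.
move=> tv tw; rewrite -g'omE //; last exact: tangent_push.
by rewrite dmapK.
Qed.

Lemma vfield_vpush X : vfield A X -> vfield A (vpush g g' X).
Proof.
move=> [tX sX]; split=> [x|f sf]; first exact: tangent_push (tX _).
have /(smooth_fam_comp gg') := sX (f \o g) ((smooth_fun_comp f gg').1 sf).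
by [].
Qed.

Lemma linear_at_lconj y L : linear_at A (g' y) L -> linear_at A y (lconj g g' L).
Proof.
move=> [tL lL]; split=> [v tv|a v w tv tw].
  by apply: tangent_push; apply: tL; exact: tangent_pull.
by rewrite /lconj -[dmap g' (a *: v + w)]/(a *: dmap g' v + dmap g' w) lL //;
  exact: tangent_pull.
Qed.

Lemma cx_struct_lconj y (j : vec -> vec) :
  cx_struct A om (g' y) j -> cx_struct A om y (lconj g g' j).
Proof.
move=> [lj jj jom jpos]; have [tj _] := lj.
split=> [|v tv|v w tv tw|v tv v0]; first exact: linear_at_lconj.
- rewrite /lconj (dmapK _ K) jj; last exact: tangent_pull.
  by rewrite -[dmap g (- _)]/(- dmap g _) dmapK.
- rewrite /lconj om_pull; [|exact: tj (tangent_pull _)|].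
    by rewrite (dmapK _ K) jom ?g'omE //; exact: tangent_pull.
  by apply: tangent_push; apply: tj; exact: tangent_pull.
- have tv' := tangent_pull tv.
  rewrite -g'omE //; last by apply: tangent_push; exact: tj.
  rewrite /lconj (dmapK _ K); apply: jpos => // v'0; apply: v0.
  by rewrite -(dmapK v K') v'0.
Qed.

Lemma cx_tangent_lconj y (j b : vec -> vec) : linear_at A (g' y) j ->
  cx_tangent A om (g' y) j b ->
  cx_tangent A om y (lconj g g' j) (lconj g g' b).
Proof.
move=> [tj _] [lb bj bom]; have [tb _] := lb.
split=> [|v tv|v w tv tw]; first exact: linear_at_lconj.
- have := bj _ (tangent_pull tv); rewrite /lconj !(dmapK _ K) => E.
  by rewrite -[LHS]/(dmap g (_ + _)) E.
- have tv' := tangent_pull tv; have tw' := tangent_pull tw.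
  rewrite !om_pull //; try (by apply: tangent_push; auto); try (by auto).
  by rewrite /lconj !(dmapK _ K) bom.
Qed.

Lemma basis_at_dmap y (e : 'I_(n + n) -> vec) :
  basis_at A (g' y) e -> basis_at A y (fun i => dmap g (e i)).
Proof.
move=> [te be]; split=> [i|v tv]; first exact: tangent_push.
have dsum (h : M -> M) (a : 'rV[R]_(n + n)) (u : 'I_(n + n) -> vec) :
    dmap h (\sum_i a 0 i *: u i) = \sum_i a 0 i *: dmap h (u i).
  by apply/funext => f; rewrite /dmap !fct_sumE.
have [a [va ua]] := be _ (tangent_pull tv); exists a; split.
  by rewrite -dsum -va dmapK.
move=> a' va'; apply: ua; rewrite va' dsum.
by apply: eq_bigr => i _; rewrite dmapK.
Qed.

(** In the pushed basis the conjugated endomorphism has the same matrix. *)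
Lemma trace_set_lconj y L : trace_set (g' y) L `<=` trace_set y (lconj g g' L).
Proof.
move=> r [e [a [be Le ->]]]; exists (fun i => dmap g (e i)), a; split=> //.
  exact: basis_at_dmap.
move=> j; rewrite /lconj (dmapK _ K) Le.
by apply/funext => f; rewrite /dmap !fct_sumE.
Qed.

End Push.

Definition scal_set J x : set R := [set r |
  exists nab rho, [/\ canonical_connection A om J nab, ricci_form A J nab rho &
    forall v : 'I_n * bool -> vec, (forall i, tangent A x (v i)) ->
      r * wedge (fun _ : 'I_n => om x) v =
      n%:R * wedge (fun i : 'I_n => if i == 0%N :> nat then rho x else om x) v]].

(** * Geodesics, connections and scalar curvature *)

Section Push2.
Variables g g' : M -> M.
Hypothesis sg : symp_pair A om g g'.

Let gg' : inverse_diffeos A g g' := sg.1.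
Let K : cancel g g'. Proof. by case: gg'. Qed.
Let K' : cancel g' g. Proof. by case: gg'. Qed.
Let sg' : symp_pair A om g' g := symp_pairC sg.

Lemma trace_at_lconj y L : trace_at A y (lconj g g' L) = trace_at A (g' y) L.
Proof.
rewrite /trace_at; congr xget; apply/seteqP; split; last exact: trace_set_lconj sg _ _.
have := trace_set_lconj sg' (y := g' y) (L := lconj g g' L).
by rewrite K' (lconjK _ K).
Qed.

Lemma geodesic_lconj y c : geodesic A om (g' y) c ->
  geodesic A om y (fun t => lconj g g' (c t)).
Proof.
move=> [cc sc gc]; split=> [t t01|v f tv sf|t b t01 tb].
- exact: cx_struct_lconj (cc t t01).
- have sfg := (smooth_fun_comp f gg').1 sf.
  exact: (smooth_fam_comp gg' (sc _ _ (tangent_pull sg tv) sfg)).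
- have lc : linear_at A y (lconj g g' (c t)).
    have t01' : 0 <= t <= 1 by case/andP: t01 => /ltW -> /ltW ->.
    by apply: linear_at_lconj sg _ _ _; case: (cc t t01').
  have tb' : cx_tangent A om (g' y) (c t) (lconj g' g b).
    rewrite -[c t](lconjK _ K); apply: (cx_tangent_lconj sg'); rewrite K' //.
  (* Since [lconj g g' (c s) v f] is [c s (dmap g' v) (f \o g)], differentiation in [s] commutes
     with conjugation by conversion. *)
  set D := fun v f => derive1n 2 (fun s => lconj g g' (c s) v f) t.
  have -> : D \o b =
      lconj g g' ((fun v f => derive1n 2 (fun s => c s v f) t) \o lconj g' g b).
    by apply/funext => v; rewrite /lconj /= (dmapK _ K').
  by rewrite trace_at_lconj; exact: gc t _ t01 tb'.
Qed.

Lemma smooth_endo_fam_push k (u : 'rV[R]_k -> endo) :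
  smooth_endo_fam A u -> smooth_endo_fam A (fun z => endo_push g g' (u z)).
Proof.
move=> su X f vX sf.
(* Testing the pushed family on [X] and [f] at [x] is testing [u] on the pulled-back field and
   [f \o g] at [g' x]. *)
have := su _ _ (vfield_vpush sg' vX) ((smooth_fun_comp f gg').1 sf).
move=> /(smooth_fam_comp gg'); rewrite /vpush /smooth_fam /= => H z x c Cz Ac cx.
have [U [h [oU Ux Ch eh]]] := H z x c Cz Ac cx.
exists U, h; split=> // z' y Uy Cz' cy; rewrite -(eh z' y Uy Cz' cy).
by rewrite /endo_push /lconj K'.
Qed.

Lemma calJ_push J : calJ A om J -> calJ A om (endo_push g g' J).
Proof.
move=> [cJ sJ]; split; last exact: smooth_endo_fam_push sJ.
by move=> x; exact: cx_struct_lconj.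
Qed.

Lemma eq_endo_push J J' : eq_endo A J J' ->
  eq_endo A (endo_push g g' J) (endo_push g g' J').
Proof.
by move=> JJ' x v tv; congr (dmap g _); apply: JJ'; exact: (tangent_pull sg tv).
Qed.

Lemma geodesic_path_push J0 J1 c : geodesic_path A om J0 J1 c ->
  geodesic_path A om (endo_push g g' J0) (endo_push g g' J1)
    (fun t => endo_push g g' (c t)).
Proof.
move=> [gc c0 c1]; split; [|exact: eq_endo_push c0|exact: eq_endo_push c1].
by move=> x; exact: geodesic_lconj.
Qed.

(** Moving [om x v (J x w)] along [g] requires [J x w] to be tangent, since [om] is preserved on
    tangent vectors. *)
Definition preserves_tangent J := forall x v, tangent A x v -> tangent A x (J x v).

Lemma herm_push J x v w : preserves_tangent J -> tangent A x v -> tangent A x w ->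
  herm om (endo_push g g' J) x v w = herm om J (g' x) (dmap g' v) (dmap g' w).
Proof.
move=> tJ tv tw; have tv' := tangent_pull sg tv; have tw' := tangent_pull sg tw.
rewrite /herm /endo_push /lconj sg'.2 //; congr Complex.
have tJw : tangent A x (dmap g (J (g' x) (dmap g' w))).
  by apply: (tangent_push sg); exact: tJ.
by rewrite -[LHS](sg'.2 x v _ tv tJw) (dmapK _ K).
Qed.

Lemma applyJ_push J X :
  applyJ (endo_push g g' J) X = vpush g g' (applyJ J (vpush g' g X)).
Proof. by apply/funext => x; rewrite /applyJ /endo_push /lconj /vpush K'. Qed.

Definition nab_push (nab : connection_op) : connection_op :=
  fun X Y => vpush g g' (nab (vpush g' g X) (vpush g' g Y)).

Lemma smul_vpush (h h' : M -> M) f X :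
  vpush h h' (smul f X) = smul (f \o h') (vpush h h' X).
Proof. by []. Qed.

Lemma connection_push nab : connection A nab -> connection A (nab_push nab).
Proof.
move=> [nv nl na nd]; have vp X := vfield_vpush sg' (X := X).
split=> [X Y vX vY|f X X' Y sf vX vX' vY|X Y Y' vX vY vY'|f X Y sf vX vY].
- by apply: vfield_vpush sg _ _; apply: nv; exact: vp.
- rewrite /nab_push -[vpush g' g (_ + _)]/(smul (f \o g) (vpush g' g X) + vpush g' g X').
  rewrite nl; [|exact: (smooth_fun_comp f gg').1|exact: vp..].
  apply/funext => x.
  rewrite -[LHS]/(((f \o g) (g' x)) *: nab_push nab X Y x + nab_push nab X' Y x).
  by rewrite /= K'.
- rewrite /nab_push -[vpush g' g (_ + _)]/(vpush g' g Y + vpush g' g Y').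
  by rewrite na; [|exact: vp..].
- rewrite /nab_push smul_vpush nd; [|exact: (smooth_fun_comp f gg').1|exact: vp..].
  apply/funext => x.
  rewrite -[LHS]/(dmap g (vpush g' g X (g' x) (f \o g) *: vpush g' g Y (g' x))
     + ((f \o g) (g' x)) *: nab_push nab X Y x).
  rewrite /= /vpush K' -[dmap g (_ *: _)]/(_ *: dmap g (dmap g' (Y x))) dmapK //.
  rewrite /dmap; congr (_ *: _ + _).
  by congr (X x); apply/funext => z /=; rewrite K'.
Qed.

Lemma torsion_push nab X Y :
  torsion (nab_push nab) X Y = vpush g g' (torsion nab (vpush g' g X) (vpush g' g Y)).
Proof.
by rewrite /torsion (bracket_vpush _ _ K') // -[bracket X Y in LHS](vpushK _ K').
Qed.

Lemma curvature_push nab X Y Z : curvature (nab_push nab) X Y Z =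
  vpush g g' (curvature nab (vpush g' g X) (vpush g' g Y) (vpush g' g Z)).
Proof. by rewrite /curvature /nab_push !(vpushK _ K) (bracket_vpush _ _ K'). Qed.

Lemma canonical_connection_push J nab : preserves_tangent J ->
  canonical_connection A om J nab ->
  canonical_connection A om (endo_push g g' J) (nab_push nab).
Proof.
move=> tJ [cn nJ nh nT]; have vp X := vfield_vpush sg' (X := X).
split=> [|X Y vX vY|X Y Z vX vY vZ x|X Y vX vY].
- exact: connection_push.
- rewrite !applyJ_push /nab_push !(vpushK _ K) nJ //; exact: vp.
- have [nv _ _ _] := cn.
  have tv V y : vfield A V -> tangent A y (V y) by case.
  have tn V : vfield A V -> tangent A (g' x) (nab (vpush g' g X) (vpush g' g V) (g' x)).
    by move=> vV; case: (nv _ _ (vp _ vX) (vp _ vV)).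
  rewrite !herm_push // ?(dmapK _ K) //; try exact: tv;
    try by apply: tangent_push sg _ _ _; exact: tn.
  have := nh _ _ _ (vp _ vX) (vp _ vY) (vp _ vZ) (g' x).
  have vE V : vpush g' g V (g' x) = dmap g' (V x) by rewrite /vpush K'.
  rewrite !vE => <-; apply: (congr1 (dirC (X x))); apply/funext => y.
  by rewrite herm_push //; [rewrite /= /vpush K'|exact: tv|exact: tv].
- rewrite !applyJ_push !torsion_push !(vpushK _ K).
  by rewrite -[LHS]/(vpush g g' (_ + _)) nT //; exact: vp.
Qed.

Lemma two_form_push b : two_form A b -> two_form A (bpush g g' b).
Proof.
move=> [lb ab sb]; split=> [x a u v w tu tv tw|x v w tv tw|X Y vX vY].
- by apply: lb; exact: (tangent_pull sg).
- by apply: ab; exact: (tangent_pull sg).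
- have /(smooth_fam_comp gg') := sb _ _ (vfield_vpush sg' vX) (vfield_vpush sg' vY).
  congr smooth_fam; apply/funext => _; apply/funext => x.
  by rewrite /= /bpush /vpush K'.
Qed.

Lemma closed_form_push b : closed_form A b -> closed_form A (bpush g g' b).
Proof.
move=> cb X Y Z vX vY vZ x.
have := cb _ _ _ (vfield_vpush sg' vX) (vfield_vpush sg' vY) (vfield_vpush sg' vZ) (g' x).
rewrite !(bracket_vpush _ _ K') /vpush K' /bpush => <-.
congr (_ + _ + _ - _ - _ - _); rewrite [RHS]/dmap; congr (_ x _);
  by apply/funext => y /=; rewrite K'.
Qed.

Lemma dmap_upd (h : M -> M) (v : 'I_n -> vec) j w :
  (fun k => dmap h (upd v j w k)) = upd (fun k => dmap h (v k)) j (dmap h w).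
Proof. by apply/funext => k; rewrite /upd; case: ifP. Qed.

(** The direction is from the pushed structure back to [J]: [ricci_form] quantifies over all volume
    forms, so a form given on the pushed side must be pulled back before the hypothesis on [rho]
    applies. *)
Lemma cvol_form_push J x al : cvol_form A (endo_push g g' J) x al ->
  cvol_form A J (g' x) (fun w : 'I_n -> vec => al (fun k => dmap g (w k))).
Proof.
move=> cal v tv; have tgv k := tangent_push sg (tv k).
have [al1 alJ al0] := cal _ tgv; split=> [j a w w' tw tw'|j|j k jk vjk].
- by rewrite !dmap_upd -al1 //; exact: (tangent_push sg).
- by rewrite dmap_upd -(alJ j) /endo_push /lconj (dmapK _ K).
- by apply: (al0 j k) => //; rewrite vjk.
Qed.

Lemma ricci_form_push J nab rho : ricci_form A J nab rho ->
  ricci_form A (endo_push g g' J) (nab_push nab) (bpush g g' rho).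
Proof.
move=> [tr cr hr]; split; [exact: two_form_push|exact: closed_form_push|].
move=> X Y Z vX vY vZ x al /cvol_form_push cal.
have := hr _ _ (fun k => vpush g' g (Z k)) (vfield_vpush sg' vX) (vfield_vpush sg' vY)
  (fun k => vfield_vpush sg' (vZ k)) (g' x) _ cal.
have vE V : vpush g' g V (g' x) = dmap g' (V x) by rewrite /vpush K'.
have ZE : (fun k => dmap g (vpush g' g (Z k) (g' x))) = (fun k => Z k x).
  by apply/funext => k; rewrite vE dmapK.
rewrite !vE ZE => <-; apply: eq_bigr => j _.
by rewrite dmap_upd ZE curvature_push.
Qed.

Lemma scal_set_push J x : preserves_tangent J ->
  scal_set J (g' x) `<=` scal_set (endo_push g g' J) x.
Proof.
move=> tJ r [nab [rho [cn rr wr]]].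
exists (nab_push nab), (bpush g g' rho); split.
- exact: canonical_connection_push.
- exact: ricci_form_push.
move=> v tv; have tv' i := tangent_pull sg (tv i).
(* The forms correspond on tangent vectors, so the wedge products are compared at the given tangent
   [v]. *)
have wE (b b' : 'I_n -> vec -> vec -> R) :
    (forall i w w', tangent A x w -> tangent A x w' ->
       b' i w w' = b i (dmap g' w) (dmap g' w')) ->
    wedge b' v = wedge b (fun ib => dmap g' (v ib)).
  move=> bb'; rewrite /wedge; congr (_ * _); apply: eq_bigr => s _.
  by congr (_ * _); apply: eq_bigr => i _; exact: bb'.
rewrite (wE (fun=> om (g' x))) => [|i w w' tw tw']; last by rewrite sg'.2.
rewrite wr //; congr (_ * _); apply/esym/wE => i w w' tw tw'.
by case: ifP => // _; rewrite sg'.2.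
Qed.

Lemma preserves_tangent_push J :
  preserves_tangent J -> preserves_tangent (endo_push g g' J).
Proof.
move=> tJ x v tv; apply: (tangent_push sg); apply: tJ; exact: (tangent_pull sg tv).
Qed.

End Push2.

(** * Integrals over M: the moment map, [Omega] and the area *)

Section Push3.
Variable mu : {measure set (borel M) -> \bar R}.
Hypotheses (cM : compact [set: M]) (lmu : liouville A om mu).
Variables g g' : M -> M.
Hypothesis sg : symp_pair A om g g'.

Let gg' : inverse_diffeos A g g' := sg.1.
Let K : cancel g g'. Proof. by case: gg'. Qed.
Let K' : cancel g' g. Proof. by case: gg'. Qed.
Let sg' : symp_pair A om g' g := symp_pairC sg.

Lemma scal_push J x : preserves_tangent J ->
  scal A om (endo_push g g' J) x = scal A om J (g' x).
Proof.
move=> tJ; rewrite /scal; congr xget; apply/seteqP; split;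
  last exact: scal_set_push sg _ _ tJ.
have := scal_set_push sg' (x := g' x) (preserves_tangent_push sg tJ).
by rewrite K' (endo_pushK _ K).
Qed.

Lemma intM_comp (F : M -> R) : intM mu (F \o g') = intM mu F.
Proof.
have [_ _ sgg sgg'] := gg'.
have mf h : smooth_map A h -> measurable_fun setT (h : borel M -> borel M).
  by move=> /smooth_map_continuous /continuous_borel.
exact: (@Rintegral_comp_automorphism _ (borel M) R mu F g' g K' K (mf _ sgg')
  (mf _ sgg) (fun B => liouville_invariant cM lmu sg)).
Qed.

Lemma moment_push (H : M -> R) J : preserves_tangent J ->
  moment A om mu (H \o g') (endo_push g g' J) = moment A om mu H J.
Proof.
move=> tJ; rewrite /moment -[RHS]intM_comp; congr intM.
by apply/funext => x; rewrite scal_push.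
Qed.

Lemma Omega_push J a b :
  Omega A mu (endo_push g g' J) (endo_push g g' a) (endo_push g g' b) =
  Omega A mu J a b.
Proof.
rewrite /Omega -[RHS]intM_comp; congr intM; apply/funext => x /=.
rewrite -(trace_at_lconj sg); congr (_ * trace_at A x _).
by apply/funext => v; rewrite /endo_push /lconj /= !(dmapK _ K).
Qed.

(** The partial derivatives in [area] are taken after evaluation at [x], [v], [f], and [endo_push]
    acts by changing these arguments; it commutes with them by conversion. *)
Lemma area_push u :
  area A mu (fun s t => endo_push g g' (u s t)) = area A mu u.
Proof.
apply: eq_Rintegral => s _; apply: eq_Rintegral => t _; exact: Omega_push.
Qed.

End Push3.
End GeometricTransport.

(** * Conjugation of Hamiltonian paths *)

Section Paths.
Context {R : realType} {M : ptopologicalType} {n : nat}.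
Variables (A : smooth_structure R M (n + n)) (om : @bform R M).
Variable mu : {measure set (borel M) -> \bar R}.

Local Notation vec := (@vec R M).
Local Notation endo := (@endo R M).
Local Notation mpath := (@mpath R M).
Implicit Types (g : M -> M) (p q : mpath) (a b : set mpath) (J : endo).

Lemma Symp_pair psi : Symp A om psi -> symp_pair A om psi (finv psi).
Proof. by move=> [dpsi ompsi]; split=> //; exact: diffeo_inverse. Qed.

(** Convertible to [conj_path psi] for [g := psi] and [g' := finv psi]. *)
Definition cpath g g' p : mpath := fun t => g \o p t \o g'.
Definition cclass g g' a : set mpath := [set cpath g g' p | p in a].

Lemma cpathK g g' : cancel g' g -> cancel (cpath g' g) (cpath g g').
Proof. by move=> K' p; apply/funext => t; apply/funext => x; rewrite /cpath /= !K'. Qed.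

Lemma cclassK g g' : cancel g' g -> cancel (cclass g' g) (cclass g g').
Proof.
move=> K' a; rewrite /cclass image_comp.
by under eq_imagel do rewrite /= cpathK //; rewrite image_id.
Qed.

Lemma cpath_id g g' : cancel g' g -> cpath g g' (fun=> id) = fun=> id.
Proof. by move=> K'; apply/funext => t; apply/funext => x; rewrite /cpath /= K'. Qed.

Lemma cpath_comp g g' p q : cancel g g' ->
  cpath g g' (fun t => p t \o q t) = fun t => cpath g g' p t \o cpath g g' q t.
Proof. by move=> K; apply/funext => t; apply/funext => x; rewrite /cpath /= K. Qed.

Local Notation hclass := (hclass A).

(** * Conjugation of homotopy classes *)

Section Conjugation.
Variable P : set mpath.
Hypothesis PC : forall g g', symp_pair A om g g' -> forall p, P p -> P (cpath g g' p).

Lemma homotopic_cpath g g' p q : symp_pair A om g g' ->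
  homotopic A P p q -> homotopic A P (cpath g g' p) (cpath g g' q).
Proof.
move=> sg [h [sh Ph h1 h0p h1q]]; exists (fun s => cpath g g' (h s)); split.
- exact: smooth_map_fam_conj sg.1 sh.
- by move=> s s01; apply: PC sg _ (Ph s s01).
- by move=> s s01; rewrite /cpath h1.
- by move=> t t01; rewrite /cpath h0p.
- by move=> t t01; rewrite /cpath h1q.
Qed.

Lemma cclass_hclass g g' p : symp_pair A om g g' ->
  cclass g g' (hclass P p) = hclass P (cpath g g' p).
Proof.
move=> sg; have [[K K' _ _] _] := sg; apply/seteqP; split=> [_ [q pq <-]|q pq].
  exact: homotopic_cpath.
exists (cpath g' g q); last by rewrite cpathK.
by have := homotopic_cpath (symp_pairC sg) pq; rewrite (cpathK K).
Qed.

Lemma cclass_mul g g' a b : symp_pair A om g g' ->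
  cclass g g' (cover_mul A P a b) = cover_mul A P (cclass g g' a) (cclass g g' b).
Proof.
have sub h h' c d : symp_pair A om h h' ->
  cclass h h' (cover_mul A P c d) `<=` cover_mul A P (cclass h h' c) (cclass h h' d).
  move=> sh _ [r [p [q [cp dq pqr]] <-]]; have [[K _ _ _] _] := sh.
  exists (cpath h h' p), (cpath h h' q); split; [by exists p|by exists q|].
  by rewrite -cpath_comp //; exact: homotopic_cpath.
move=> sg; have [[K K' _ _] _] := sg; apply/seteqP; split; first exact: sub.
move=> r abr; rewrite -(cpathK K' r); exists (cpath g' g r) => //.
have := sub _ _ (cclass g g' a) (cclass g g' b) (symp_pairC sg).
by rewrite !(cclassK K); apply; exists r.
Qed.

Lemma cclass_pow g g' a k : symp_pair A om g g' ->
  cclass g g' (cover_pow A P a k) = cover_pow A P (cclass g g' a) k.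
Proof.
move=> sg; have [[_ K' _ _] _] := sg; rewrite /cover_pow.
elim: k => [|k IH] /=; first by rewrite cclass_hclass // cpath_id.
by rewrite cclass_mul // IH.
Qed.

End Conjugation.

Hypotheses (cM : compact [set: M]) (lmu : liouville A om mu).

Local Notation ham_path := (ham_path A om mu).

(** The pushed field is generated by [H t \o g'] because [dmap g] and [dmap g'] are adjoint for
    [om]; the normalization survives because the measure is invariant. *)
Lemma ham_isotopy_cpath g g' p H : symp_pair A om g g' ->
  ham_isotopy A om mu p H ->
  ham_isotopy A om mu (cpath g g' p) (fun t => H t \o g').
Proof.
move=> sg [[sp dp] p0 sH H0 [X XP]]; have [gg' _] := sg; have [K K' _ _] := gg'.
split.
- split; first exact: smooth_map_fam_conj gg' sp.
  by move=> t t01; exact: inverse_diffeos_diffeo (inverse_diffeos_conj (dp t t01) gg').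
- by rewrite /cpath p0; apply/funext => x /=; rewrite K'.
- exact: smooth_fam_comp gg' sH.
- by move=> t t01; rewrite (intM_comp cM lmu sg) H0.
exists (fun t => vpush g g' (X t)) => t t01; have [vX dX omX] := XP t t01; split.
- exact: (vfield_vpush sg).
- move=> x f sf; rewrite /vpush /cpath /= K.
  exact: dX (g' x) (f \o g) ((smooth_fun_comp f gg').1 sf).
- move=> x v tv; have tv' := tangent_pull sg tv.
  rewrite /vpush (om_pull sg) //; last by case: vX.
  by rewrite omX.
Qed.

Lemma ham_path_cpath g g' : symp_pair A om g g' ->
  forall p, ham_path p -> ham_path (cpath g g' p).
Proof.
move=> sg p [H pH]; exists (fun t => H t \o g'); exact: ham_isotopy_cpath.
Qed.

(** Functoriality of push-forward: the orbit of the pushed structure under the conjugated path is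
    the push of the original orbit. *)
Lemma push_cpath g g' f J : symp_pair A om g g' -> bijective f ->
  push (g \o f \o g') (endo_push g g' J) = endo_push g g' (push f J).
Proof.
move=> [[K K' _ _] _] bf.
rewrite (@pushE _ _ _ (g \o finv f \o g')); last 2 first.
- by move=> x /=; rewrite K (finvK bf).
- by move=> x /=; rewrite K (finvKV bf).
apply/funext => x; apply/funext => w; rewrite /endo_push /lconj /push /= K.
rewrite -[dmap (g \o f \o g') _]/(dmap g (dmap f (dmap g' (dmap g _)))) (dmapK _ K).
rewrite -[dmap (g \o finv f \o g') _]/(dmap g (dmap (finv f) (dmap g' _))).
by rewrite (dmapK _ K).
Qed.

Lemma filling_cpath g g' J p u H : symp_pair A om g g' ->
  ham_isotopy A om mu p H -> filling A om J p u ->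
  filling A om (endo_push g g' J) (cpath g g' p) (fun s t => endo_push g g' (u s t)).
Proof.
move=> sg [[_ dp] _ _ _ _] [su Ju u0 uJ u1].
have pp t : 0 <= t <= 1 ->
    push (cpath g g' p t) (endo_push g g' J) = endo_push g g' (push (p t) J).
  by move=> /dp [bp _ _]; exact: push_cpath.
have t1 : 0 <= (1 : R) <= 1 by rewrite ler01 lexx.
split.
- exact: (smooth_endo_fam_push sg su).
- by move=> s t s01 t01; apply: (calJ_push sg); exact: Ju.
- by move=> t t01; rewrite pp //; apply: (eq_endo_push sg); exact: u0.
- move=> s s01; rewrite pp //; have [us0 us1] := uJ s s01.
  by split; apply: (eq_endo_push sg).
- by rewrite pp //; apply: (geodesic_path_push sg).
Qed.

Lemma preserves_tangent_pushd f J :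
  diffeo A f -> preserves_tangent A J -> preserves_tangent A (push f J).
Proof.
move=> df tJ x v tv; have ff' := diffeo_inverse df; have [_ K' _ _] := ff'.
rewrite /push -[X in tangent A X _]K'; apply: (tangent_dmap ff'); apply: tJ.
exact: (tangent_dmap (inverse_diffeosC ff')).
Qed.

Definition frakS_set J a : set R := [set r | exists p H u,
    [/\ a p, ham_isotopy A om mu p H, filling A om J p u &
        r = area A mu u - Rintegral (@lebesgue_measure R) `[0, 1]
                       (fun t => moment A om mu (H t) (push (p t) J))]].

Lemma frakS_set_cclass g g' J a : symp_pair A om g g' -> calJ A om J ->
  frakS_set J a `<=` frakS_set (endo_push g g' J) (cclass g g' a).
Proof.
move=> sg cJ r [p [H [u [ap pH fu ->]]]].
exists (cpath g g' p), (fun t => H t \o g'), (fun s t => endo_push g g' (u s t)).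
split; [by exists p|exact: ham_isotopy_cpath|exact: filling_cpath pH fu|].
rewrite (area_push cM lmu sg); congr (_ - _); apply: eq_Rintegral => t.
rewrite inE /= in_itv /= => t01.
have [[_ dp] _ _ _ _] := pH; have dpt := dp t t01; have [bp _ _] := dpt.
rewrite push_cpath // (moment_push cM lmu sg) //.
apply: (preserves_tangent_pushd dpt) => x v tv.
by have [/(_ x) [[tj _] _ _ _] _] := cJ; exact: tj.
Qed.

Lemma frakS_at_cclass g g' J a : symp_pair A om g g' -> calJ A om J ->
  frakS_at A om mu (endo_push g g' J) (cclass g g' a) = frakS_at A om mu J a.
Proof.
move=> sg cJ; have [[K K' _ _] _] := sg.
suff E : frakS_set (endo_push g g' J) (cclass g g' a) = frakS_set J a.
  exact: (congr1 (xget 0) E).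
apply/seteqP; split; last exact: frakS_set_cclass.
have := @frakS_set_cclass _ _ (endo_push g g' J) (cclass g g' a) (symp_pairC sg)
  (calJ_push sg cJ).
by rewrite (endo_pushK _ K) (cclassK K).
Qed.

Lemma is_frakS_conj S J psi a : is_frakS A om mu S -> calJ A om J ->
  Symp A om psi -> Ham_tilde A om mu a -> S (conj_class psi a) = S a.
Proof.
move=> HS cJ /Symp_pair sg Ha.
have Hc : Ham_tilde A om mu (conj_class psi a).
  have [p hp ->] := Ha; exists (conj_path psi p); first exact: (ham_path_cpath sg hp).
  exact: (cclass_hclass ham_path_cpath _ sg).
(* [is_frakS] holds for every base structure; with the pushed [J] for the conjugate class, the two
   sequences agree term by term. *)
have lc := HS _ (calJ_push sg cJ) _ Hc.
have la := HS _ cJ _ Ha.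
have E k : frakS_at A om mu (endo_push psi (finv psi) J)
    (cover_pow A ham_path (conj_class psi a) k) =
    frakS_at A om mu J (cover_pow A ham_path a k).
  rewrite -[conj_class psi a]/(cclass psi (finv psi) a).
  by rewrite -(cclass_pow ham_path_cpath _ _ sg) frakS_at_cclass.
have {E}E := funext (fun k : nat => congr1 (fun r => k%:R^-1 * r) (E k)).
rewrite E in lc.
exact: (cvg_unique _ lc la).
Qed.

End Paths.

(** * Constant homotopies *)

Section ConstantHomotopy.
Context {R : realType} {M : ptopologicalType} {m : nat}.
Variable A : smooth_structure R M m.

(** With [2 + m] read as [1 + (1 + m)], dropping the first coordinate forgets the homotopy parameter
    and keeps time and position. *)
Lemma rsubmx_row_mx2 (z : 'rV[R]_2) (y : 'rV[R]_m) :
  rsubmx (row_mx z y : 'rV[R]_(1 + (1 + m))) = row_mx (const_mx (z 0 1) : 'rV_1) y.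
Proof.
apply/rowP => j; rewrite mxE.
case: (split_ordP j) => k ->.
  rewrite row_mxEl [RHS]mxE -(row_mxEl z y 0 1).
  have E : rshift 1 (lshift m k) = lshift m 1 :> 'I_(2 + m).
    by apply: val_inj; rewrite /= (ord1 k).
  exact: (congr1 (row_mx z y 0) E).
rewrite row_mxEr -(row_mxEr z y 0 k).
have E : rshift 1 (rshift 1 k) = rshift 2 k :> 'I_(2 + m) by exact: val_inj.
exact: (congr1 (row_mx z y 0) E).
Qed.

Lemma rsubmx_basis_vec (i : 'I_(1 + (1 + m))) :
  rsubmx (@basis_vec R _ i) = 0 \/
  exists j, rsubmx (@basis_vec R _ i) = basis_vec j :> 'rV_(1 + m).
Proof.
case: (split_ordP i) => k ->; [left|right; exists k]; apply/rowP => j; rewrite !mxE //=.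
  by rewrite eq_rlshift.
Qed.

(** Joint smoothness of the constant homotopy comes from composing the local extensions of [p] with
    the projection that forgets the homotopy parameter. *)
Lemma homotopic_refl (P : set (@mpath R M)) p :
  smooth_path A p -> P p -> homotopic A P p p.
Proof.
move=> sp Pp; exists (fun=> p); split=> // z x c d Cz Ac Ad cx dx.
pose z1 : 'rV[R]_1 := const_mx (z 0 1).
have Cz1 (z' : 'rV[R]_2) : cube z' -> cube (const_mx (z' 0 1) : 'rV[R]_1).
  by move=> Cz' i; rewrite mxE.
have dx1 : cdom d (p (z1 0 0) x) by rewrite mxE.
have [U [G [oU Ux CG eG]]] := sp z1 x c d (Cz1 z Cz) Ac Ad cx dx1.
pose L : {linear 'rV[R]_(1 + (1 + m)) -> 'rV[R]_(1 + m)} := rsubmx.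
have cL : continuous L by exact: continuous_rsubmx.
exists (L @^-1` U), (G \o L); split.
- by move/continuousP: cL; apply.
- by rewrite /preimage /= /L rsubmx_row_mx2.
- move=> j k; exact: (Ck_comp_proj oU cL (@rsubmx_basis_vec) (CG j k)).
move=> z' y; rewrite /preimage /= /L rsubmx_row_mx2 => Uy Cz' cy.
by have := eG _ _ Uy (Cz1 _ Cz') cy; rewrite mxE.
Qed.

End ConstantHomotopy.

(** Homotopies fix the endpoint, which gives one inclusion; the other needs a path in the class,
    namely [p] itself by [homotopic_refl]. *)
Lemma conj_class_cover_hclass (R : realType) (M : ptopologicalType) (n : nat)
    (A : smooth_structure R M (n + n)) (om : @bform R M) p (a : set (@mpath R M)) :
  symp_path A om p ->
  conj_class_cover (hclass A (symp_path A om) p) a = conj_class (p 1) a.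
Proof.
move=> sp; apply/seteqP; split=> [_ [psi [q [[h [_ _ h1 _ hpsi]] aq ->]]]|_ [q aq <-]].
  have t1 : 0 <= (1 : R) <= 1 by rewrite ler01 lexx.
  by exists q => //; rewrite -hpsi // h1.
exists p, q; split=> //; apply: homotopic_refl => //; by case: sp.
Qed.

Theorem corollary3 (R : realType) (M : ptopologicalType) (n : nat)
    (A : smooth_structure R M (n + n)) (om : @bform R M)
    (mu : {measure set (borel M) -> \bar R})
    (J0 : @endo R M) (S : set (@mpath R M) -> R) :
  compact [set: M] -> hausdorff_space M ->
  symplectic A om -> liouville A om mu -> calJ A om J0 ->
  is_frakS A om mu S ->
  (forall b a, Symp_tilde A om b -> Ham_tilde A om mu a ->
     S (conj_class_cover b a) = S a) /\
  (forall psi a, Symp A om psi -> Ham_tilde A om mu a ->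
     S (conj_class psi a) = S a).
Proof.
move=> cM _ _ lmu cJ HS.
have inv psi a : Symp A om psi -> Ham_tilde A om mu a -> S (conj_class psi a) = S a.
  exact: (is_frakS_conj cM lmu HS cJ).
split=> // b a [p sp ->] Ha; rewrite conj_class_cover_hclass //; apply: inv => //.
by have [_ _] := sp; apply; rewrite ler01 lexx.
Qed.
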